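(* Let $K_m$ be a complete graph on $m$ vertices and let $H$ be the disjoint union of paths $P_1',\ldots,P_t'$ such that: (1) for any $i$, if $V(K_m)\cap V(P_i')\neq\emptyset$, then $V(K_m)\cap V(P_i')=\{v_i\}$ for some vertex $v_i$ which is a free vertex of $P_i'$; (2) $V(K_m)\cap V(P_i')\cap V(P_j')=\emptyset$ for all distinct $i$ and $j$. Let $n$ be the number of edges of $H$. Then for any $n\ge 1$ and any $m\ge 2$, $$\operatorname{reg}\frac{S}{\mathcal{I}_H J_{K_m}}=2+n,$$ where $S=k[x_v,y_v : v\in V(K_m)\cup V(H)]$ is a polynomial ring over a field $k$.
   Context: For a finite simple graph $\Gamma$ whose vertices index variables of $S$: the binomial edge ideal is $J_\Gamma=(x_uy_v-x_vy_u\mid\{u,v\}\in E(\Gamma))$ and the parity binomial edge ideal is $\mathcal{I}_\Gamma=(x_ux_v-y_uy_v\mid\{u,v\}\in E(\Gamma))$. $\mathcal{I}_HJ_{K_m}$ is the product ideal. A free vertex of a graph is a vertex contained in only one maximal clique (for a path: an end vertex). $\operatorname{reg}$ denotes Castelnuovo–Mumford regularity over $S$ with the standard grading. *)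

(* Defs.v *)
From HB Require Import structures.
From mathcomp Require Import all_boot all_order all_algebra.
From mathcomp Require Import mpoly.

Set Implicit Arguments.
Unset Strict Implicit.
Unset Printing Implicit Defensive.

Import GRing.Theory.
Local Open Scope ring_scope.

(** * Finite simple graphs *)

(* The vertices of a graph form a subset of an ambient finite type, so that
   several graphs can share vertices; an edge is the two-element set of its
   ends. *)
Record sgraph (T : finType) := SGraph {
  vset : {set T};
  eset : {set {set T}};
  _ : [forall e in eset, (#|e| == 2) && (e \subset vset)]
}.

Section Graphs.
Variable T : finType.
Implicit Types G : sgraph T.

Definition is_complete G : Prop :=
  eset G = [set e : {set T} | (#|e| == 2) && (e \subset vset G)].

(* The path on distinct vertices x = p_0, ..., p_l: the edges are the pairs of
   consecutive vertices.  A single vertex (l = 0) is a path. *)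
Definition is_path G : Prop :=
  exists (x : T) (p : seq T),
    [/\ uniq (x :: p),
        vset G = [set y in x :: p]
      & eset G = [set [set e.1; e.2] | e in zip (x :: p) p]].

Definition clique G (C : {set T}) : bool :=
  (C \subset vset G) &&
  [forall u in C, forall v in C, (u != v) ==> ([set u; v] \in eset G)].

Definition free_vertex G (v : T) : bool :=
  #|[set C : {set T} | maxset (clique G) C && (v \in C)]| == 1.

Definition is_disjoint_union (t : nat) (P : 'I_t -> sgraph T) G : Prop :=
  [/\ forall i j : 'I_t, i != j -> [disjoint vset (P i) & vset (P j)],
      vset G = \bigcup_(i < t) vset (P i)
    & eset G = \bigcup_(i < t) eset (P i)].

End Graphs.

(** * Ideals *)

Section Ideals.
Variable R : comNzRingType.

Definition ideal_gen (A : R -> Prop) (f : R) : Prop :=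
  exists2 s : seq (R * R),
    (forall cg, cg \in s -> A cg.2) & f = \sum_(cg <- s) cg.1 * cg.2.

Definition ideal_mul (I J : R -> Prop) : R -> Prop :=
  ideal_gen (fun h => exists f g, [/\ I f, J g & h = f * g]).

End Ideals.

Section EdgeIdeals.
Variables (k : fieldType) (T : finType).

(* k[x_v, y_v : v in T], with the x-variables numbered first. *)
Local Notation S := {mpoly k[#|T| + #|T|]}.

Definition xvar (v : T) : S := 'X_(lshift #|T| (enum_rank v)).
Definition yvar (v : T) : S := 'X_(rshift #|T| (enum_rank v)).

Definition binomial_edge_ideal (G : sgraph T) : S -> Prop :=
  ideal_gen (fun f => exists u v,
    [set u; v] \in eset G /\ f = xvar u * yvar v - xvar v * yvar u).

Definition parity_binomial_edge_ideal (G : sgraph T) : S -> Prop :=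
  ideal_gen (fun f => exists u v,
    [set u; v] \in eset G /\ f = xvar u * xvar v - yvar u * yvar v).

End EdgeIdeals.

(** * Castelnuovo-Mumford regularity of S/I, S = k[X_0, ..., X_(N-1)] *)

Section Regularity.
Variables (k : fieldType) (N : nat).
Local Notation S := {mpoly k[N]}.

(* A minimal graded free resolution of S/I for the standard grading,
     ... -> F_2 -> F_1 -> F_0 -> S/I -> 0,   F_i = \bigoplus_a S(- shift i a).
   An element of F_i is a row vector, and maps act by right multiplication:
   row a of [diff i] is the image in F_i of the a-th basis vector of F_(i+1),
   and [aug] lifts F_0 -> S/I to a map F_0 -> S.  All shifts are natural
   numbers since S/I lives in nonnegative degrees. *)
Record min_graded_res (I : S -> Prop) := MinGradedRes {
  rank : nat -> nat;
  shift : forall i, 'I_(rank i) -> nat;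
  aug : 'cV[S]_(rank 0);
  diff : forall i, 'M[S]_(rank i.+1, rank i);
  (* The maps are homogeneous of degree 0. *)
  aug_homog : forall a, aug a 0 \is (shift a).-homog;
  diff_homog : forall i a b mon, mon \in msupp (diff i a b) ->
    (mdeg mon + shift b = shift a)%N;
  aug_surj : forall f : S, exists u : 'rV_(rank 0), I (f - (u *m aug) 0 0);
  exact0 : forall u : 'rV_(rank 0),
    I ((u *m aug) 0 0) <-> exists v, u = v *m diff 0;
  exactS : forall i (u : 'rV_(rank i.+1)),
    u *m diff i = 0 <-> exists v, u = v *m diff i.+1;
  (* Minimality: the image of F_(i+1) lies in (X_0, ..., X_(N-1)) F_i. *)
  diff_min : forall i a b, (diff i a b)@_0%MM = 0
}.

Definition betti (I : S -> Prop) (F : min_graded_res I) (i j : nat) : nat :=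
  #|[set a : 'I_(rank F i) | shift a == j]|.

(* reg S/I = max {j - i | betti_(i, j) (S/I) <> 0}; minimal graded free
   resolutions are unique up to isomorphism, so any one of them will do. *)
Definition reg_quotient_eq (I : S -> Prop) (r : int) : Prop :=
  exists F : min_graded_res I,
    (forall i j, betti F i j != 0%N -> j%:Z - i%:Z <= r)
    /\ (exists i j, betti F i j != 0%N /\ j%:Z - i%:Z = r).

End Regularity.

(* Main.v *)
(* Write J for J_K and f_1, ..., f_n for the generators of I_H, taken path by
   path and outwards from K.  They form a regular sequence both on S and on S/J,
   so (f_1, ..., f_j) meets J in (f_1, ..., f_j) J and each f_j is injective on
   J / (f_1, ..., f_(j-1)) J.  The resolution of (f_1, ..., f_j) J is then glued
   from that of (f_1, ..., f_(j-1)) J and, shifted by 2, the mapping cone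
   resolving J / (f_1, ..., f_(j-1)) J.  Starting from the linear resolution of J,
   each f_j after the first raises the regularity by exactly one.

   The linear resolution of J comes by adding one vertex w at a time:
   J_(m+1) / J_m is isomorphic to (x_1, ..., x_m) / J_m via
   x_u |-> x_u y_w - x_w y_u, and the latter is resolved by the cone of the
   inclusion J_m -> (x_1, ..., x_m).

   The regularity on S/J reduces to x_v being a nonzerodivisor modulo J and the
   paths already attached, for v in K not yet the end of a path.  The next edge
   of a path then has a fresh end vertex, and a X - b Y, with X, Y fresh and a a
   nonzerodivisor, is a nonzerodivisor. *)
From HB Require Import structures.
From Stdlib Require Import IndefiniteDescription.
Require Import Defs.
From mathcomp Require Import all_boot all_order all_algebra.
From mathcomp Require Import mpoly.
From mathcomp Require Import zify ring.

Set Implicit Arguments.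
Unset Strict Implicit.
Unset Printing Implicit Defensive.

Import GRing.Theory.
Local Open Scope ring_scope.

(** * Graded complexes *)

Section Complexes.
Variables (k : fieldType) (N : nat).
Local Notation S := {mpoly k[N]}.

(** The regularity is read off the shifts of one minimal resolution, so every gluing has to stay
    minimal. Mostly degrees ensure this: J has shift [i + 2] in step i and (f_1, ..., f_(j-1)) J has
    shifts at least [i + 4], so the comparison map into the resolution of J has no constant entry.
    Where degrees do not suffice, the connecting map is written down explicitly. The first generator
    raises all shifts of J by 2; each later one adds a copy of the old complex one step further with
    shifts raised by 2. The largest shift in step i is thus at most i + 4 + (n - 1), and passing
    from the ideal to its quotient ring lowers the difference by one, to 2 + n. The obstacle is x_v,
    for v in K, once a path has been attached at another vertex of K: J + (x_v) is not prime but the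
    intersection of (x_u : u in K) and J + (x_v, y_v). The two components are reached by setting all
    x_u, respectively x_v and y_v, to zero. *)

Definition hmx p q (sp : 'I_p -> nat) (sq : 'I_q -> nat) (M : 'M[S]_(p, q)) :=
  forall a b mon, mon \in msupp (M a b) -> (mdeg mon + sq b = sp a)%N.

Definition min_mx p q (M : 'M[S]_(p, q)) := forall a b, (M a b)@_0%MM = 0.

Definition sh_sum p q (sp : 'I_p -> nat) (sq : 'I_q -> nat) (a : 'I_(p + q)) :=
  match split a with inl b => sp b | inr c => sq c end.

Lemma hmx_block p1 p2 q1 q2 (sp1 : 'I_p1 -> nat) (sp2 : 'I_p2 -> nat)
    (sq1 : 'I_q1 -> nat) (sq2 : 'I_q2 -> nat) A B C D :
  hmx sp1 sq1 A -> hmx sp1 sq2 B -> hmx sp2 sq1 C -> hmx sp2 sq2 D ->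
  hmx (sh_sum sp1 sp2) (sh_sum sq1 sq2) (block_mx A B C D).
Proof.
move=> hA hB hC hD a b mon; rewrite /sh_sum /block_mx !mxE.
by case: (split a) => a'; rewrite !mxE; case: (split b) => b';
  [apply: hA | apply: hB | apply: hC | apply: hD].
Qed.

Lemma hmx_col p1 p2 q (sp1 : 'I_p1 -> nat) (sp2 : 'I_p2 -> nat)
    (sq : 'I_q -> nat) A B :
  hmx sp1 sq A -> hmx sp2 sq B -> hmx (sh_sum sp1 sp2) sq (col_mx A B).
Proof.
move=> hA hB a b mon; rewrite /sh_sum !mxE.
by case: (split a) => a'; [apply: hA | apply: hB].
Qed.

Lemma hmx0 p q (sp : 'I_p -> nat) (sq : 'I_q -> nat) : hmx sp sq 0.
Proof. by move=> a b mon; rewrite mxE msupp0. Qed.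

Lemma hmxN p q (sp : 'I_p -> nat) (sq : 'I_q -> nat) M :
  hmx sp sq M -> hmx sp sq (- M).
Proof.
by move=> hM a b mon; rewrite mxE mcoeff_msupp mcoeffN oppr_eq0 -mcoeff_msupp; apply: hM.
Qed.

Lemma hmx_mul p q r (sp : 'I_p -> nat) (sq : 'I_q -> nat) (sr : 'I_r -> nat) M P :
  hmx sp sq M -> hmx sq sr P -> hmx sp sr (M *m P).
Proof.
move=> hM hP a c mon; rewrite mxE => /msupp_sum_le /flattenP [s /mapP [b _ ->]].
move=> /msuppM_le /allpairsP [[m1 m2] /= [h1 h2 ->]].
by rewrite mdegD -(hM _ _ _ h1) -(hP _ _ _ h2) addnA.
Qed.

Lemma min_mx0 p q : min_mx (0 : 'M[S]_(p, q)).
Proof. by move=> a b; rewrite mxE mcoeff0. Qed.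

Lemma min_mx_block p1 p2 q1 q2 (A : 'M[S]_(p1, q1)) (B : 'M_(p1, q2))
    (C : 'M_(p2, q1)) (D : 'M_(p2, q2)) :
  min_mx A -> min_mx B -> min_mx C -> min_mx D -> min_mx (block_mx A B C D).
Proof.
move=> hA hB hC hD a b; rewrite /block_mx !mxE.
by case: (split a) => a'; rewrite !mxE; case: (split b) => b'.
Qed.

Lemma min_mx_col p1 p2 q (A : 'M[S]_(p1, q)) (B : 'M_(p2, q)) :
  min_mx A -> min_mx B -> min_mx (col_mx A B).
Proof. by move=> hA hB a b; rewrite !mxE; case: (split a) => a';
  [apply: hA | apply: hB]. Qed.

(** A constant term in an entry would have degree 0 and so force the two shifts to agree. *)
Lemma min_mx_shift p q (sp : 'I_p -> nat) (sq : 'I_q -> nat) M :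
  hmx sp sq M -> (forall a b, sp a != sq b) -> min_mx M.
Proof.
move=> hM ne a b; apply/eqP; rewrite -[_ == _]negbK -mcoeff_msupp.
by apply/negP => /hM; rewrite mdeg0 add0n => e; move: (ne a b); rewrite e eqxx.
Qed.

(* The component of degree a - b, which is 0 when a < b. *)
Definition hcomp (a b : nat) (p : S) : S :=
  \sum_(m <- msupp p | (mdeg m + b)%N == a) p@_m *: 'X_[m].

Lemma mcoeff_hcomp a b p m :
  (hcomp a b p)@_m = if (mdeg m + b)%N == a then p@_m else 0.
Proof.
rewrite /hcomp big_mkcond raddf_sum /=.
rewrite (eq_bigr (fun m' => if m' == m then
    (if (mdeg m + b)%N == a then p@_m else 0) else 0)); last first.
  move=> m' _; case: (eqVneq m' m) => [->|ne].
    by case: ifP; rewrite ?mcoeff0 // mcoeffZ mcoeffX eqxx mulr1.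
  by case: ifP; rewrite ?mcoeff0 // mcoeffZ mcoeffX (negPf ne) mulr0.
rewrite -big_mkcond /=; case: (boolP (m \in msupp p)) => hm.
  by rewrite (big_rem m) //= eqxx big1_seq ?addr0 // => m' /andP [/eqP ->];
    rewrite mem_rem_uniqF.
rewrite big1_seq => [|m' /andP [/eqP -> h]]; last by rewrite h in hm.
by rewrite memN_msupp_eq0 // if_same.
Qed.

Lemma hcompM a b c p q :
  (forall m, m \in msupp q -> (mdeg m + c)%N = b) ->
  hcomp a b p * q = hcomp a c (p * q).
Proof.
move=> hq; apply/mpolyP => m; rewrite mcoeff_hcomp !mcoeffM.
case: ifP => ac; last first.
  apply: big1 => -[m1 m2] /= /eqP E; rewrite mcoeff_hcomp.
  case: ifP => [/eqP h1|_]; last by rewrite mul0r.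
  case: (boolP ((m2 : 'X_{1..N}) \in msupp q)) => h2; last first.
    by rewrite (memN_msupp_eq0 h2) mulr0.
  by move/hq: h2 => h2; rewrite E mdegD -addnA h2 h1 eqxx in ac.
apply: eq_bigr => -[m1 m2] /= /eqP E; rewrite mcoeff_hcomp.
case: (boolP ((m2 : 'X_{1..N}) \in msupp q)) => h2; last first.
  by rewrite (memN_msupp_eq0 h2) !mulr0.
by move/hq: h2 => h2; rewrite -h2 addnA -mdegD -E ac.
Qed.

Lemma hcomp_id a b p :
  (forall m, m \in msupp p -> (mdeg m + b)%N = a) -> hcomp a b p = p.
Proof.
move=> hp; apply/mpolyP => m; rewrite mcoeff_hcomp; case: ifP => // /negP h.
case: (boolP (m \in msupp p)) => hm; last by rewrite memN_msupp_eq0.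
by case: h; rewrite hp.
Qed.

Lemma hcomp_sum I (r : seq I) a b (F : I -> S) :
  hcomp a b (\sum_(i <- r) F i) = \sum_(i <- r) hcomp a b (F i).
Proof.
apply/mpolyP => m; rewrite mcoeff_hcomp !raddf_sum /=.
by rewrite (eq_bigr _ (fun i _ => mcoeff_hcomp a b (F i) m)); case: ifP => // _;
  rewrite big1.
Qed.

(** Since U and D are homogeneous, keeping only the component of the right degree in each entry of V
    does not change the product. Exactness, which speaks of ungraded vectors, thus still yields
    homogeneous lifts. *)
Lemma hlift p q r (sp : 'I_p -> nat) (sq : 'I_q -> nat) (sr : 'I_r -> nat) U D :
  hmx sp sr U -> hmx sq sr D -> (exists V, U = V *m D) ->
  exists V, hmx sp sq V /\ U = V *m D.
Proof.
move=> hU hD [V UVD]; exists (\matrix_(a, b) hcomp (sp a) (sq b) (V a b)); split.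
  move=> a b mon; rewrite mxE mcoeff_msupp mcoeff_hcomp.
  by case: ifP => [/eqP ->|] //; rewrite eqxx.
apply/matrixP => a c; rewrite -[LHS](hcomp_id (a := sp a) (b := sr c)); last exact: hU.
rewrite UVD !mxE hcomp_sum; apply: eq_bigr => b _.
by rewrite mxE (@hcompM _ _ (sr c)) // => m /hD.
Qed.

Lemma rows_lift p q r (U : 'M[S]_(p, r)) (D : 'M[S]_(q, r)) :
  (forall a, exists v, row a U = v *m D) -> exists V, U = V *m D.
Proof.
move=> h; have [v hv] := fin_all_exists h; exists (\matrix_a v a).
by apply/row_matrixP => a; rewrite hv row_mul rowK.
Qed.

Record cplx := Cplx {
  rk : nat -> nat;
  sh : forall i, 'I_(rk i) -> nat;
  df : forall i, 'M[S]_(rk i.+1, rk i) }.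

Definition hom_cplx C := forall i, hmx (@sh C i.+1) (@sh C i) (df C i).
Definition min_cplx C := forall i, min_mx (df C i).
Definition acyclic C := forall i (u : 'rV_(rk C i.+1)),
  u *m df C i = 0 <-> exists v, u = v *m df C i.+1.

Lemma acyclic_dd C i : acyclic C -> df C i.+1 *m df C i = 0.
Proof.
move=> ac; apply/row_matrixP => a; rewrite row_mul row0.
by apply/ac; exists (delta_mx 0 a); rewrite rowE.
Qed.

(** One block-triangular construction serves twice: with [susp] in the second slot it is a mapping
    cone, without it the gluing of resolutions along a short exact sequence. *)
Definition tot (A C : cplx) (th : forall i, 'M[S]_(rk C i.+1, rk A i)) : cplx :=
  @Cplx (fun i => rk A i + rk C i)%N (fun i => sh_sum (@sh A i) (@sh C i))
    (fun i => block_mx (df A i) 0 (th i) (df C i)).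

Definition susp (C : cplx) : cplx :=
  @Cplx (fun i => if i is j.+1 then rk C j else 0%N)
    (fun i => match i return 'I_(if i is j.+1 then rk C j else 0%N) -> nat with
              | 0 => fun _ => 0%N | j.+1 => @sh C j end)
    (fun i => match i return 'M[S]_(rk C i, if i is j.+1 then rk C j else 0%N) with
              | 0 => 0 | j.+1 => df C j end).

Definition twist (d : nat) (C : cplx) : cplx :=
  @Cplx (rk C) (fun i a => @sh C i a + d)%N (df C).

Definition trunc (C : cplx) : cplx :=
  @Cplx (fun i => rk C i.+1) (fun i => @sh C i.+1) (fun i => df C i.+1).

(** The sign of the mapping cone is absorbed here, so that the blocks of [tot] carry none. *)
Definition anti (C A : cplx) (th : forall i, 'M[S]_(rk C i, rk A i)) :=
  forall i, th i.+1 *m df A i = - (df C i *m th i).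

(** The last hypothesis asks for exactness of C only at cycles that extend to cycles of the total
    complex. A suspended resolution need not be exact at step 1, so the mapping cone relies on this
    weaker form. *)
Lemma tot_acyclic A C (th : forall i, 'M[S]_(rk C i.+1, rk A i)) :
  acyclic A -> (forall i, df C i.+1 *m df C i = 0) -> @anti (trunc C) A th ->
  (forall i (c : 'rV_(rk C i.+1)) a, c *m df C i = 0 -> a *m df A i + c *m th i = 0 ->
     exists v, c = v *m df C i.+1) ->
  acyclic (tot th).
Proof.
move=> acA ddC an hC i u; split=> [|[v ->]]; last first.
  rewrite -mulmxA /= mulmx_block !(mul0mx, mulmx0, addr0, add0r) acyclic_dd //.
  by rewrite ddC an /= addNr -[block_mx _ _ _ _]/(block_mx 0 0 0 0) block_mx0 mulmx0.
rewrite -[u]hsubmxK; move: (lsubmx u) (rsubmx u) => a c /=.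
rewrite mul_row_block mulmx0 add0r -row_mx0 => /eq_row_mx [h0 h1].
have [v cv] := hC i c a h1 h0.
have : (a - v *m th i.+1) *m df A i = 0.
  by rewrite mulmxBl -mulmxA an mulmxN opprK mulmxA /= -cv.
move/acA => [w aw]; exists (row_mx w v).
by rewrite mul_row_block mulmx0 add0r -aw -cv subrK.
Qed.

Lemma tot_hom A C (th : forall i, 'M[S]_(rk C i.+1, rk A i)) :
  hom_cplx A -> hom_cplx C -> (forall i, hmx (@sh C i.+1) (@sh A i) (th i)) ->
  hom_cplx (tot th).
Proof. by move=> hA hC hth i; apply: hmx_block => //; apply: hmx0. Qed.

Lemma tot_min A C (th : forall i, 'M[S]_(rk C i.+1, rk A i)) :
  min_cplx A -> min_cplx C -> (forall i, min_mx (th i)) -> min_cplx (tot th).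
Proof. by move=> hA hC hth i; apply: min_mx_block => //; apply: min_mx0. Qed.

Lemma susp_hom C : hom_cplx C -> hom_cplx (susp C).
Proof. by move=> h [|i] /=; [apply: hmx0 | apply: h]. Qed.

Lemma susp_min C : min_cplx C -> min_cplx (susp C).
Proof. by move=> h [|i] /=; [apply: min_mx0 | apply: h]. Qed.

Lemma twist_hom d C : hom_cplx C -> hom_cplx (twist d C).
Proof. by move=> h i a b mon /h /= <-; rewrite addnA. Qed.

Lemma lift_seq (C A : cplx) (phi0 : 'M[S]_(rk C 0, rk A 0)) :
  (forall i, df C i.+1 *m df C i = 0) -> acyclic A -> hom_cplx C -> hom_cplx A ->
  hmx (@sh C 0) (@sh A 0) phi0 -> (exists V, df C 0 *m phi0 = V *m df A 0) ->
  exists th : forall i, 'M[S]_(rk C i, rk A i),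
    [/\ th 0 = phi0, forall i, hmx (@sh C i) (@sh A i) (th i) & anti th].
Proof.
move=> ddC acA hC hA h0 e0.
(* The invariant records that the next obstruction factors through A, which is what the following
   lift needs; successive lifts are selected by indefinite description. *)
pose ok i (M : 'M[S]_(rk C i, rk A i)) :=
  hmx (@sh C i) (@sh A i) M /\ exists V, df C i *m M = V *m df A i.
have step i (M : {M | ok i M}) : exists M' : {M | ok i.+1 M},
    sval M' *m df A i = - (df C i *m sval M).
  case: M => M [hM [V eV]] /=.
  have [V' [hV' eV']] : exists V', hmx (@sh C i.+1) (@sh A i.+1) V' /\
      - (df C i *m M) = V' *m df A i.
    apply: hlift; [exact: hmxN (hmx_mul (hC i) hM) | exact: hA |].
    by exists (- V); rewrite eV mulNmx.
  suff okV' : ok i.+1 V' by exists (exist _ V' okV').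
  split=> //; apply: rows_lift => a; apply/acA.
  by rewrite row_mul -mulmxA -eV' mulmxN mulmxA -row_mul ddC row0 mul0mx oppr0.
pose next i M := sval (constructive_indefinite_description _ (step i M)).
pose th : forall i, {M | ok i M} :=
  nat_rect (fun i => {M | ok i M}) (exist _ phi0 (conj h0 e0)) next.
exists (fun i => sval (th i)); split=> // [i|i].
  by case: (svalP (th i)).
exact: svalP (constructive_indefinite_description _ (step i (th i))).
Qed.

End Complexes.

(** * Ideals and regular sequences *)

Section Ideals.
Variable R : comNzRingType.
Implicit Types Q M : R -> Prop.

Record is_ideal Q : Prop := IsIdeal {
  id0 : Q 0;
  idD : forall a b, Q a -> Q b -> Q (a + b);
  idM : forall c a, Q a -> Q (c * a) }.

Lemma idN Q a : is_ideal Q -> Q a -> Q (- a).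
Proof. by move=> iQ Qa; rewrite -mulN1r; apply: idM. Qed.

Lemma idB Q a b : is_ideal Q -> Q a -> Q b -> Q (a - b).
Proof. by move=> iQ Qa Qb; apply: idD => //; apply: idN. Qed.

Lemma idMr Q c a : is_ideal Q -> Q a -> Q (a * c).
Proof. by move=> iQ Qa; rewrite mulrC; apply: idM. Qed.

Lemma id_sum Q (I : Type) (r : seq I) (P : pred I) F :
  is_ideal Q -> (forall i, P i -> Q (F i)) -> Q (\sum_(i <- r | P i) F i).
Proof. by move=> iQ h; elim/big_ind: _ => //; [apply: id0 | apply: idD]. Qed.

Definition zero_ideal : R -> Prop := fun h => h = 0.
Definition unit_ideal : R -> Prop := fun _ => True.

Lemma is_ideal_zero : is_ideal zero_ideal.
Proof.
by split=> [|a b -> ->|c a ->]; rewrite /zero_ideal ?addr0 ?mulr0.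
Qed.

Lemma is_ideal_unit : is_ideal unit_ideal.
Proof. by []. Qed.

(** One recursion for two uses: for Q zero it is the product of (s) and M, for M the unit ideal it
    is Q + (s). *)
Fixpoint comb (s : seq R) Q M : R -> Prop :=
  if s is f :: s' then
    fun h => exists a c, [/\ comb s' Q M a, M c & h = a + f * c]
  else Q.

Lemma is_ideal_comb s Q M : is_ideal Q -> is_ideal M -> is_ideal (comb s Q M).
Proof.
move=> iQ iM; elim: s => [|f s iS] //=; split.
- by exists 0, 0; rewrite mulr0 addr0; split=> //; apply: id0.
- move=> _ _ [a [c [ha hc ->]]] [a' [c' [ha' hc' ->]]].
  by exists (a + a'), (c + c'); split; [exact: idD | exact: idD | ring].
- move=> c' _ [a [c [ha hc ->]]]; exists (c' * a), (c' * c).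
  by split; [exact: idM | exact: idM | ring].
Qed.

Lemma comb_base s Q M h : is_ideal M -> Q h -> comb s Q M h.
Proof.
move=> iM hh; elim: s => //= f s IH; exists h, 0.
by rewrite mulr0 addr0; split=> //; apply: id0.
Qed.

Lemma comb_gen s Q M f c : is_ideal Q -> is_ideal M ->
  f \in s -> M c -> comb s Q M (f * c).
Proof.
move=> iQ iM; elim: s => //= g s IH; rewrite inE => /predU1P [->|/IH h] hc.
  by exists 0, c; rewrite add0r; split=> //; apply: id0 (is_ideal_comb s iQ iM).
exists (f * c), 0; rewrite mulr0 addr0; split; [exact: h | exact: id0 |] => //.
Qed.

Lemma comb_min s Q M (L : R -> Prop) : is_ideal L ->
  (forall h, Q h -> L h) -> (forall f c, f \in s -> M c -> L (f * c)) ->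
  forall h, comb s Q M h -> L h.
Proof.
move=> iL hQ; elim: s => //= f s IH hs _ [a [c [ha hc ->]]].
apply: idD => //; last by apply: hs; rewrite ?mem_head.
by apply: IH => // g c' hg; apply: hs; rewrite inE hg orbT.
Qed.

Definition nzd M Q f := forall g, M g -> Q (f * g) -> Q g.

(* The last element of the sequence comes first in the list. *)
Fixpoint regular (s : seq R) Q M : Prop :=
  if s is f :: s' then regular s' Q M /\ nzd M (comb s' Q M) f else True.

Lemma comb_cat s1 s2 Q M : comb (s1 ++ s2) Q M = comb s1 (comb s2 Q M) M.
Proof. by elim: s1 => //= f s1 ->. Qed.

Lemma regular_cat s1 s2 Q M :
  regular (s1 ++ s2) Q M <-> regular s2 Q M /\ regular s1 (comb s2 Q M) M.
Proof.
elim: s1 => [|f s1 IH] /=; first by split=> [|[]].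
by rewrite comb_cat IH; split=> [[[]]|[? []]].
Qed.

Lemma comb_sub s1 s2 Q h : is_ideal Q -> {subset s1 <= s2} ->
  comb s1 Q unit_ideal h -> comb s2 Q unit_ideal h.
Proof.
move=> iQ ss; apply: comb_min => [|h' hh|f c /ss hf _].
- by apply: is_ideal_comb => //; apply: is_ideal_unit.
- by apply: comb_base => //; apply: is_ideal_unit.
- by apply: comb_gen.
Qed.

End Ideals.
Arguments zero_ideal {R} _.
Arguments unit_ideal {R} _.

Local Notation nz Q f := (nzd unit_ideal Q f).

(** * Resolutions, mapping cones and extensions *)

Section Resolutions.
Variables (k : fieldType) (N : nat).
Local Notation S := {mpoly k[N]}.
Implicit Types (A B M : S -> Prop) (C G : cplx k N).

(* [C] resolves the subquotient B / A of S, generator a mapping to [aug a]. *)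
Record resolution C (aug : 'cV[S]_(rk C 0)) B A : Prop := Resolution {
  res_hom : hom_cplx C;
  res_min : min_cplx C;
  res_acyclic : acyclic C;
  res_aug_hom : hmx (@sh _ _ C 0) (fun=> 0%N) aug;
  res_aug : forall a, B (aug a 0);
  res_surj : forall f, B f -> exists u : 'rV_(rk C 0), A (f - (u *m aug) 0 0);
  res_ker : forall u : 'rV_(rk C 0), A ((u *m aug) 0 0) <-> exists v, u = v *m df C 0 }.

Lemma res_df_aug C aug B A a : resolution (C := C) aug B A ->
  A ((df C 0 *m aug) a 0).
Proof.
move=> r; suff -> : (df C 0 *m aug) a 0 = (row a (df C 0) *m aug) 0 0.
  by apply/(res_ker r); exists (delta_mx 0 a); rewrite rowE.
by rewrite -row_mul [RHS]mxE.
Qed.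

Lemma res_df_aug0 C aug B : resolution (C := C) aug B zero_ideal ->
  df C 0 *m aug = 0.
Proof.
by move=> r; apply/matrixP => a b; rewrite ord1 (res_df_aug a r) mxE.
Qed.

Lemma row_aug q p (M : 'M[S]_(q, p)) (aug : 'cV[S]_p) a :
  (row a M *m aug) 0 0 = (M *m aug) a 0.
Proof. by rewrite -row_mul mxE. Qed.

Lemma row_augE C aug B A (u : 'rV_(rk C 0)) : is_ideal B -> resolution (C := C) aug B A ->
  B ((u *m aug) 0 0).
Proof.
by move=> iB r; rewrite mxE; apply: id_sum => // a _; apply: idM => //; exact: (res_aug r).
Qed.

Lemma scalar_mx_ext (u v : 'M[S]_1) : u 0 0 = v 0 0 -> u = v.
Proof. by move=> h; apply/matrixP => i j; rewrite !ord1. Qed.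

Lemma lift_col q (sq : 'I_q -> nat) (X : 'cV[S]_q) C (aug : 'cV[S]_(rk C 0)) :
  hmx sq (fun=> 0%N) X -> hmx (@sh _ _ C 0) (fun=> 0%N) aug ->
  (forall a, exists u : 'rV_(rk C 0), X a 0 = (u *m aug) 0 0) ->
  exists V, hmx sq (@sh _ _ C 0) V /\ X = V *m aug.
Proof.
move=> hX ha h; apply: (hlift hX ha); apply: rows_lift => a; case: (h a) => u hu.
by exists u; apply: scalar_mx_ext; rewrite mxE.
Qed.

Definition cplx0 : cplx k N := @Cplx k N (fun=> 0%N) (fun _ _ => 0%N) (fun=> 0).

Lemma cplx0_res : resolution (C := cplx0) 0 zero_ideal zero_ideal.
Proof.
split=> [i|i|i u||a|f ->|u]; do ?[by move=> [] | by case: a].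
- by split=> _; [exists 0; rewrite mulmx0; apply/matrixP => ? [] | apply/matrixP => ? []].
- by exists 0; rewrite mulmx0 mxE subr0.
- by split=> _; [exists 0; rewrite mulmx0; apply/matrixP => ? [] | rewrite mulmx0 mxE].
Qed.

Definition cplx1 : cplx k N :=
  @Cplx k N (fun i => (i == 0)%N : nat) (fun _ _ => 0%N) (fun=> 0).

Lemma cplx1_res : resolution (C := cplx1) (const_mx 1) unit_ideal zero_ideal.
Proof.
have zero n (u : 'rV[S]_0) : exists v : 'rV[S]_n, u = v *m 0.
  by exists 0; apply/matrixP => ? [].
split=> [i|i|i u|a b m|a|f _|u] //.
- exact: hmx0.
- exact: min_mx0.
- by split=> _; [apply: zero | apply: mulmx0].
- by rewrite mxE msupp1 inE => /eqP ->; rewrite mdeg0.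
- exists (const_mx f); rewrite /zero_ideal mxE big_ord_recl big_ord0 !mxE.
  by rewrite mulr1 addr0 subrr.
- split=> [h|[v ->]]; last by rewrite mulmx0 mul0mx /zero_ideal mxE.
  exists 0; rewrite mul0mx; apply/matrixP => i j; rewrite !ord1 mxE.
  by move: h; rewrite /zero_ideal mxE big_ord_recl big_ord0 !mxE mulr1 addr0.
Qed.

Lemma quot_lift CA augA A G augG M :
  resolution (C := CA) augA A zero_ideal -> resolution (C := G) augG M zero_ideal ->
  (forall h, A h -> M h) ->
  exists io : forall i, 'M[S]_(rk CA i, rk G i),
    [/\ io 0%N *m augG = augA, forall i, hmx (@sh _ _ CA i) (@sh _ _ G i) (io i)
      & anti io].
Proof.
move=> rA rG AM.
have [V [hV eV]] : exists V, hmx (@sh _ _ CA 0) (@sh _ _ G 0) V /\ augA = V *m augG.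
  apply: lift_col; [exact: res_aug_hom rA | exact: res_aug_hom rG |] => a.
  have [u /eqP] := res_surj rG (AM _ (res_aug rA a)).
  by rewrite subr_eq0 => /eqP ->; exists u.
have [||||||io [h0 h1 h2]] := @lift_seq _ _ CA G V.
- by move=> i; apply: acyclic_dd (res_acyclic rA).
- exact: res_acyclic rG.
- exact: res_hom rA.
- exact: res_hom rG.
- exact: hV.
- apply: rows_lift => a; apply/(res_ker rG).
  by rewrite row_aug -mulmxA -eV (res_df_aug0 rA) /zero_ideal mxE.
by exists io; rewrite h0 -eV.
Qed.

(* The mapping cone of CA -> G. *)
Lemma quot_res CA augA A G augG M (io : forall i, 'M[S]_(rk CA i, rk G i)) :
  resolution (C := CA) augA A zero_ideal -> resolution (C := G) augG M zero_ideal ->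
  is_ideal A -> is_ideal M -> (forall h, A h -> M h) ->
  io 0%N *m augG = augA -> (forall i, hmx (@sh _ _ CA i) (@sh _ _ G i) (io i)) ->
  (forall i, min_mx (io i)) -> anti io ->
  resolution (C := @tot _ _ G (susp CA) io) (col_mx augG 0) M A.
Proof.
move=> rA rG iA iM AM e0 hio mio an.
have dA0 : df CA 0 *m augA = 0 := res_df_aug0 rA.
have dG0 : df G 0 *m augG = 0 := res_df_aug0 rG.
split.
- by apply: tot_hom; [exact: res_hom rG | apply: susp_hom; exact: res_hom rA | exact: hio].
- by apply: tot_min; [exact: res_min rG | apply: susp_min; exact: res_min rA | exact: mio].
- apply: tot_acyclic => //; first exact: res_acyclic rG.
    move=> [|i] /=; first by rewrite mulmx0.
    exact: acyclic_dd (res_acyclic rA).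
  move=> [|i] c a /=; last by move=> h _; apply/(res_acyclic rA).
  move=> _ h; apply/(res_ker rA).
  move: (congr1 (mulmx^~ augG) h); rewrite mulmxDl -!mulmxA dG0 mulmx0 add0r e0.
  by rewrite mul0mx /zero_ideal => ->; rewrite mxE.
- by apply: hmx_col; [exact: res_aug_hom rG | exact: hmx0].
- move=> a; rewrite mxE; case: (split a) => b; first exact: res_aug rG b.
  by rewrite mxE; apply: id0.
- move=> f /(res_surj rG) [u hu]; exists (row_mx u 0).
  by rewrite mul_row_col mul0mx addr0 hu; apply: id0.
move=> u; rewrite -[u]hsubmxK; move: (lsubmx u) (rsubmx u) => a c.
rewrite mul_row_col mulmx0 addr0; split.
  move=> /(res_surj rA) [w]; rewrite -e0 mulmxA => h.
  have [v hv] : exists v, a - w *m io 0%N = v *m df G 0.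
    by apply/(res_ker rG); rewrite mulmxBl /zero_ideal [LHS]mxE [X in _ + X]mxE.
  exists (row_mx v w); rewrite mul_row_block mulmx0 add0r -hv subrK mulmx0.
  by congr row_mx; apply/matrixP => ? [].
move=> [w]; rewrite -[w]hsubmxK; move: (lsubmx w) (rsubmx w) => v w' /=.
rewrite mul_row_block => /eq_row_mx [-> _].
rewrite mulmxDl -!mulmxA dG0 mulmx0 add0r e0.
exact: row_augE rA.
Qed.

(** Gluing along 0 -> A -> B -> B / A -> 0. The augmentation of C takes values in B itself, so the
    relations of C are sent into A rather than to zero; [th] corrects for this. *)
Lemma ext_res CA augA A C augC B (th : forall i, 'M[S]_(rk C i.+1, rk CA i)) :
  resolution (C := CA) augA A zero_ideal -> resolution (C := C) augC B A ->
  is_ideal A -> is_ideal B -> (forall h, A h -> B h) ->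
  th 0%N *m augA = - (df C 0 *m augC) ->
  (forall i, hmx (@sh _ _ C i.+1) (@sh _ _ CA i) (th i)) ->
  (forall i, min_mx (th i)) -> @anti _ _ (trunc C) CA th ->
  resolution (C := @tot _ _ CA C th) (col_mx augA augC) B zero_ideal.
Proof.
move=> rA rC iA iB AB e0 hth mth an.
have dA0 : df CA 0 *m augA = 0 := res_df_aug0 rA.
split.
- by apply: tot_hom; [exact: res_hom rA | exact: res_hom rC | exact: hth].
- by apply: tot_min; [exact: res_min rA | exact: res_min rC | exact: mth].
- apply: tot_acyclic => //; first exact: res_acyclic rA.
    by move=> i; apply: acyclic_dd (res_acyclic rC).
  by move=> i c a h _; apply/(res_acyclic rC).
- by apply: hmx_col; [exact: res_aug_hom rA | exact: res_aug_hom rC].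
- move=> a; rewrite mxE; case: (split a) => b; last exact: res_aug rC b.
  by apply: AB; apply: res_aug rA b.
- move=> f /(res_surj rC) [u /(res_surj rA) [v h]]; exists (row_mx v u).
  by rewrite mul_row_col [X in _ - X]mxE opprD [X in _ + X]addrC addrA.
move=> u; rewrite -[u]hsubmxK; move: (lsubmx u) (rsubmx u) => a c.
rewrite mul_row_col; split=> [h|[w]].
  have [v cv] : exists v, c = v *m df C 0.
    apply/(res_ker rC); move: h; rewrite /zero_ideal mxE addrC => /eqP.
    by rewrite addr_eq0 => /eqP ->; apply: idN => //; apply: row_augE rA.
  have [w hw] : exists w, a - v *m th 0%N = w *m df CA 0.
    apply/(res_ker rA); rewrite mulmxBl -mulmxA e0 mulmxN opprK mulmxA.
    by rewrite -cv.
  by exists (row_mx w v); rewrite mul_row_block mulmx0 add0r -hw subrK -cv.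
rewrite -[w]hsubmxK; move: (lsubmx w) (rsubmx w) => v w' /=.
rewrite mul_row_block mulmx0 add0r => /eq_row_mx [-> ->].
by rewrite mulmxDl -!mulmxA dA0 mulmx0 add0r e0 mulmxN addNr /zero_ideal mxE.
Qed.

Lemma ext_lift CA augA A C augC B :
  resolution (C := CA) augA A zero_ideal -> resolution (C := C) augC B A ->
  exists th : forall i, 'M[S]_(rk C i.+1, rk CA i),
    [/\ th 0%N *m augA = - (df C 0 *m augC),
        forall i, hmx (@sh _ _ C i.+1) (@sh _ _ CA i) (th i)
      & @anti _ _ (trunc C) CA th].
Proof.
move=> rA rC.
have [V [hV eV]] : exists V, hmx (@sh _ _ C 1) (@sh _ _ CA 0) V /\
    df C 0 *m augC = V *m augA.
  apply: lift_col; last first.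
  - move=> a; have [u /eqP] := res_surj rA (res_df_aug a rC).
    by rewrite subr_eq0 => /eqP ->; exists u.
  - exact: res_aug_hom rA.
  - by apply: hmx_mul (res_aug_hom rC); apply: (res_hom rC).
have [||||||th [h0 h1 h2]] := @lift_seq _ _ (trunc C) CA (- V).
- by move=> i; apply: acyclic_dd (res_acyclic rC).
- exact: res_acyclic rA.
- by move=> i; apply: (res_hom rC).
- exact: res_hom rA.
- exact: hmxN.
- apply: rows_lift => a; apply/(res_ker rA).
  rewrite row_aug -mulmxA mulNmx -eV mulmxN mulmxA.
  by rewrite (acyclic_dd _ (res_acyclic rC)) mul0mx oppr0 /zero_ideal mxE.
by exists th; rewrite h0 mulNmx -eV.
Qed.

Lemma res_ideal_ext C aug B A B' A' :
  (forall h, B h <-> B' h) -> (forall h, A h <-> A' h) ->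
  resolution (C := C) aug B A -> resolution (C := C) aug B' A'.
Proof.
move=> eB eA r; split; try by case: r.
- by move=> a; apply/eB; apply: res_aug r a.
- by move=> f /eB /(res_surj r) [u /eA]; exists u.
- by move=> u; rewrite -eA; apply: res_ker r u.
Qed.

End Resolutions.

(** * The resolution of (f_1, ..., f_n) M *)

Section ProductResolution.
Variables (k : fieldType) (N : nat).
Local Notation S := {mpoly k[N]}.
Implicit Types (A B M : S -> Prop) (C G : cplx k N).

(** Carries a resolution along an isomorphism B / A -> B' / A' of degree d, leaving the matrices of
    the complex unchanged. The instances are multiplication by a form and x_u |-> x_u y_w - x_w
    y_u. *)
Lemma res_transport d C aug B A (aug' : 'cV[S]_(rk C 0)) B' A' :
  resolution (C := C) aug B A ->
  hmx (@sh _ _ (twist d C) 0) (fun=> 0%N) aug' ->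
  (forall a, B' (aug' a 0)) ->
  (forall f, B' f -> exists u : 'rV_(rk C 0), A' (f - (u *m aug') 0 0)) ->
  (forall u : 'rV_(rk C 0), A' ((u *m aug') 0 0) <-> A ((u *m aug) 0 0)) ->
  resolution (C := twist d C) aug' B' A'.
Proof.
move=> r h0 h1 h2 h3; split=> //.
- exact: twist_hom (res_hom r).
- exact: res_min r.
- exact: res_acyclic r.
- by move=> u; rewrite h3; apply: res_ker r u.
Qed.

Lemma hmx_dhomog q (sq : 'I_q -> nat) (X : 'cV[S]_q) :
  hmx sq (fun=> 0%N) X <-> forall a, X a 0 \is (sq a).-homog.
Proof.
split=> [h a|h a b m]; first by apply/dhomogP => m /h; rewrite addn0.
by rewrite ord1 addn0 => hm; move/dhomogP: (h a); apply.
Qed.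

(* The resolution of (f_1, ..., f_j) M is glued from that of
   (f_1, ..., f_(j-1)) M and, via multiplication by f_j, that of
   M / (f_1, ..., f_(j-1)) M.  The connecting map is +- f_j on the cone part, so
   the result is again minimal. *)
Lemma comb_res M G augG c d s :
  resolution (C := G) augG M zero_ideal -> is_ideal M ->
  (forall i a, @sh _ _ G i a = i + c)%N -> (0 < d)%N ->
  (forall f, f \in s -> f \is d.-homog) -> regular s zero_ideal M ->
  exists C aug, [/\ resolution (C := C) aug (comb s zero_ideal M) zero_ideal,
    forall i a, (i + c + d <= @sh _ _ C i a)%N /\
      (@sh _ _ C i a + d.-1 <= i + c + d + size s * d.-1)%N
    & s != [::] -> (0 < rk G 0)%N ->
      exists i a, (@sh _ _ C i a + d.-1 = i + c + d + size s * d.-1)%N].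
Proof.
move=> rG iM shG d0; elim: s => [_ _|f s IH hs [reg nzf]].
  by exists (cplx0 k N), 0; split=> [|i []|] //; apply: cplx0_res.
have {IH} [|CA [augA [rA shA topA]]] := IH _ reg.
  by move=> g hg; apply: hs; rewrite inE hg orbT.
have hf : f \is d.-homog by apply: hs; rewrite mem_head.
set A := comb s zero_ideal M in nzf rA.
have iA : is_ideal A by apply: is_ideal_comb => //; apply: is_ideal_zero.
have AM h : A h -> M h.
  apply: comb_min => // [_ ->|g x _ hx]; [exact: id0 | exact: idM].
have [io [io0 hio aio]] := quot_lift rA rG AM.
have mio i : min_mx (io i).
  apply: min_mx_shift (hio i) _ => a b; rewrite shG.
  by case: (shA i a) => h _; lia.
have rW := quot_res rA rG iA iM AM io0 hio mio aio.
set W := tot _ in rW.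
have dG0 := res_df_aug0 rG.
have hfX n (a : 'I_n) b m : m \in msupp (f%:M a b) -> mdeg m = d /\ a = b.
  rewrite mxE; case: eqP => [->|_]; last by rewrite msupp0.
  by move=> hm; move/dhomogP: hf => ->.
have rW' : resolution (C := twist d W) (col_mx (f *: augG) 0)
    (comb (f :: s) zero_ideal M) A.
  have e u : (u *m col_mx (f *: augG) (0 : 'M_(0, 1))) 0 0 =
      f * (u *m col_mx augG (0 : 'M_(0, 1))) 0 0.
    by rewrite -[X in col_mx _ X](scaler0 _ f) -scale_col_mx -scalemxAr mxE.
  apply: (res_transport rW).
  - apply/hmx_dhomog => a /=; rewrite /sh_sum mxE; case: (split a) => b; rewrite mxE.
      by rewrite addnC; apply: dhomogM => //; move: b; apply/hmx_dhomog;
        apply: res_aug_hom rG.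
    exact: dhomog0.
  - move=> a; exists 0, (col_mx augG (0 : 'M_(0, 1)) a 0); split.
    + exact: id0.
    + exact: res_aug rW a.
    by rewrite add0r !mxE; case: (split a) => b; rewrite !mxE ?mulr0.
  - move=> _ [a [g [ha hg ->]]]; have [u hu] := res_surj rW hg.
    by exists u; rewrite e -addrA -mulrBr; apply: idD => //; apply: idM.
  - move=> u; rewrite e; split=> [|h]; last exact: idM.
    by apply: nzf; apply: row_augE rW.
(* A lift taken from [ext_lift] might have constant entries, since shifts of source and target can
   coincide here. The explicit map has none, because f is homogeneous of positive degree. *)
pose th i : 'M[S]_(rk W i.+1, rk CA i) :=
  col_mx 0 ((-1) ^+ i.+1 *: f%:M).
have hth i : hmx (@sh _ _ (twist d W) i.+1) (@sh _ _ CA i) (th i).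
  move=> a b m; rewrite /= /sh_sum mxE; case: (split a) => c'.
    by rewrite mxE msupp0.
  rewrite mxE -signr_odd; case: (odd _); rewrite ?mulN1r ?mul1r.
    by rewrite mcoeff_msupp mcoeffN oppr_eq0 -mcoeff_msupp => /hfX [-> ->]; rewrite addnC.
  by move=> /hfX [-> ->]; rewrite addnC.
have f00 : f@_0%MM = 0.
  apply/eqP; rewrite -[_ == _]negbK -mcoeff_msupp; apply/negP.
  by move=> /(dhomogP _ _ _ hf) /=; rewrite mdeg0; lia.
have mth i : min_mx (th i).
  apply: min_mx_col; first exact: min_mx0.
  move=> a b; rewrite !mxE -signr_odd; case: (odd _); rewrite ?mulN1r ?mul1r ?mcoeffN;
    by case: eqP; rewrite ?mcoeff0 ?f00 ?oppr0.
have ath : @anti _ _ (trunc (twist d W)) CA th.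
  move=> i; rewrite /th mul_col_mx mul0mx /= mul_block_col.
  rewrite !(mulmx0, mul0mx, add0r) opp_col_mx oppr0 -scalemxAl mul_scalar_mx.
  by rewrite -scalemxAr mul_mx_scalar [in LHS]exprS mulN1r scaleNr.
have iB : is_ideal (comb (f :: s) zero_ideal M).
  by apply: is_ideal_comb => //; apply: is_ideal_zero.
have AB h : A h -> comb (f :: s) zero_ideal M h.
  by move=> hh; exists h, 0; rewrite mulr0 addr0; split=> //; apply: id0.
have rT := @ext_res _ _ CA augA A (twist d W) _ _ th rA rW' iA iB AB.
eexists _, _; split.
- apply: rT => //.
  rewrite /th mul_col_mx mul0mx /= mul_block_col !mul0mx !addr0 -scalemxAr dG0 scaler0.
  rewrite expr1 scaleN1r mulNmx mul_scalar_mx -scalemxAr io0 opp_col_mx oppr0 //.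
- move=> i a; rewrite [size (f :: s)]/= mulSn; move: shA; move: (size s * d.-1)%N => z shA.
  rewrite /= /sh_sum; case: (split a) => {}a.
    by case: (shA i a) => h1 h2; split; lia.
  rewrite /sh_sum; case: (split a) => {}a; first by rewrite shG; split; lia.
  case: i a => [[]|i a] //=.
  by case: (shA i a) => h1 h2; split; lia.
(* For a single form the top shift is that of any generator of G. Afterwards it comes from the copy
   of [CA] in the cone: one step further and shifted by d, a gain of d - 1. *)
move=> _ rG0; rewrite [size (f :: s)]/= mulSn; case: (s =P [::]) => [->|/eqP s0].
  exists 0%N, (rshift _ (lshift _ (Ordinal rG0))).
  by rewrite /= /sh_sum !(unsplitK (inr _)) !(unsplitK (inl _)) shG /=; lia.
have [i [a h]] := topA s0 rG0; exists i.+1, (rshift _ (rshift _ a)).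
rewrite /= /sh_sum !(unsplitK (inr _)) /=; move: h; move: (size s * d.-1)%N => z; lia.
Qed.

End ProductResolution.

(** * The ideal of 2-minors is prime *)

Section Segre.
Variables (k : fieldType) (T : finType).
Local Notation N := (#|T| + #|T|)%N.
Local Notation S := {mpoly k[N]}.
Local Notation xv := (@xvar k T).
Local Notation yv := (@yvar k T).
Local Notation xi := (lshift #|T|).
Local Notation yi := (@rshift #|T| #|T|).

Definition minor (u v : T) : S := xv u * yv v - xv v * yv u.

Definition minors (l : seq T) : S -> Prop :=
  comb [seq minor u v | u <- l, v <- l] zero_ideal unit_ideal.

Lemma is_ideal_minors l : is_ideal (minors l).
Proof. by apply: is_ideal_comb; [apply: is_ideal_zero | apply: is_ideal_unit]. Qed.

Lemma minors_gen l u v : u \in l -> v \in l -> minors l (minor u v).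
Proof.
move=> hu hv; rewrite -[minor u v]mulr1; apply: comb_gen => //.
  exact: is_ideal_zero.
exact: allpairs_f.
Qed.

Lemma minors_min l (L : S -> Prop) : is_ideal L ->
  (forall u v, u \in l -> v \in l -> L (minor u v)) -> forall h, minors l h -> L h.
Proof.
move=> iL hL; apply: comb_min => // [_ ->|_ c /allpairsP [[u v] [/= hu hv ->]] _].
  exact: id0.
by apply: idMr => //; apply: hL.
Qed.

Definition segre_var (l : seq T) (i : 'I_N) : {poly S} :=
  match split i with
  | inl a => ('X_(xi a))%:P
  | inr a => if enum_val a \in l then ('X_(xi a))%:P * 'X else ('X_(yi a))%:P
  end.

(* x_u |-> x_u, y_u |-> x_u t for u in l: the generic 2 x l matrix of rank one. *)
Definition segre (l : seq T) : S -> {poly S} :=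
  mmap (@polyC S \o @mpolyC N k) (segre_var l).

HB.instance Definition _ l := GRing.RMorphism.copy (segre l)
  (mmap (@polyC S \o @mpolyC N k) (segre_var l)).

Lemma segreM l a b : segre l (a * b) = segre l a * segre l b.
Proof. exact: rmorphM. Qed.

Lemma segreB l a b : segre l (a - b) = segre l a - segre l b.
Proof. exact: rmorphB. Qed.

Lemma segre_sum l (I : Type) (r : seq I) (F : I -> S) :
  segre l (\sum_(i <- r) F i) = \sum_(i <- r) segre l (F i).
Proof. exact: rmorph_sum. Qed.

Lemma segreX l i : segre l 'X_i = segre_var l i.
Proof. by rewrite /segre mmapX mmap1U. Qed.

Lemma segre_x l u : segre l (xv u) = (xv u)%:P.
Proof. by rewrite /xvar segreX /segre_var (unsplitK (inl _)). Qed.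

Lemma segre_y l u :
  segre l (yv u) = if u \in l then (xv u)%:P * 'X else (yv u)%:P.
Proof. by rewrite /yvar segreX /segre_var (unsplitK (inr _)) enum_rankK. Qed.

(** The image of a monomial under [segre] is again a monomial; this is its exponent in S, and
    [segre_deg] is its exponent in t. *)
Definition segre_mon (l : seq T) (m : 'X_{1..N}) : 'X_{1..N} :=
  [multinom match split i with
     | inl a => m (xi a) + (enum_val a \in l) * m (yi a)
     | inr a => (enum_val a \notin l) * m (yi a)
     end | i < N]%N.

Definition segre_deg (l : seq T) (m : 'X_{1..N}) : nat :=
  (\sum_a (enum_val a \in l) * m (yi a))%N.

Lemma segre_monE l m :
  segre l 'X_[m] = ('X_[segre_mon l m])%:P * 'X^(segre_deg l m).
Proof.
rewrite /segre mmapX /mmap1 big_split_ord /= -big_split /=.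
rewrite mpolyXE_id rmorph_prod /= big_split_ord /= -big_split /=.
rewrite /segre_deg expr_sum -big_split /=; apply: eq_bigr => a _.
rewrite /segre_var !(unsplitK (inr _)) !(unsplitK (inl _)) !mnmE.
rewrite !(unsplitK (inr _)) !(unsplitK (inl _)) -!/(polyC _).
case: (enum_val a \in l); rewrite ?mul1n ?mul0n ?addn0 !rmorphXn /=;
  last by rewrite expr0 mulr1.
by rewrite expr0 mulr1 exprMn exprD mulrA.
Qed.

Lemma coef_segre l p m :
  (segre l p)`_(segre_deg l m) @_(segre_mon l m) =
  \sum_(m' <- msupp p | (segre_mon l m' == segre_mon l m) &&
                        (segre_deg l m' == segre_deg l m)) p@_m'.
Proof.
rewrite {1}[p]mpolyE [segre l _]raddf_sum /= coef_sum raddf_sum /= [RHS]big_mkcond /=.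
apply: eq_bigr => m' _; rewrite -mul_mpolyC rmorphM /= segre_monE.
rewrite {1}/segre mmapC /= coefCM coefCM coefXn mulr_natr.
rewrite mul_mpolyC mcoeffZ mcoeffMn mcoeffX.
rewrite [segre_deg l m == _]eq_sym; case: eqP; case: eqP; rewrite /= ?mulr0 ?mulr1 //.
Qed.

Lemma segre_monD l m1 m2 : segre_mon l (m1 + m2) = (segre_mon l m1 + segre_mon l m2)%MM.
Proof.
by apply/mnmP => i; rewrite !(mnmDE, mnmE); case: (split i) => a; rewrite !mnmDE; lia.
Qed.

Lemma segre_mon_y l a : enum_val a \in l -> segre_mon l U_(yi a) = segre_mon l U_(xi a).
Proof.
move=> ha; apply/mnmP => i; rewrite !mnmE; case: (split i) => b; rewrite !mnm1E.
  rewrite eq_lrshift eq_rlshift !eq_rshift !eq_lshift /= muln0 addn0.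
  by case: (eqVneq a b) => [<-|_]; rewrite ?ha // muln0.
rewrite eq_lrshift !eq_rshift muln0.
by case: (eqVneq a b) => [<-|_]; rewrite ?ha // muln0.
Qed.

Lemma segre_degD l m1 m2 : segre_deg l (m1 + m2) = (segre_deg l m1 + segre_deg l m2)%N.
Proof. by rewrite /segre_deg -big_split; apply: eq_bigr => a _; rewrite mnmDE mulnDr. Qed.

Lemma segre_deg_x l a : segre_deg l U_(xi a) = 0%N.
Proof. by apply: big1 => b _; rewrite mnm1E eq_lrshift muln0. Qed.

Lemma segre_deg_y l a : enum_val a \in l -> segre_deg l U_(yi a) = 1%N.
Proof.
move=> ha; rewrite /segre_deg (bigD1 a) //= big1 ?addn0.
  by rewrite mnm1E eqxx ha.
by move=> b ne; rewrite mnm1E eq_rshift eq_sym (negPf ne) muln0.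
Qed.

(** Equal images have the same total y-degree, so unless m = m' some y_a occurs too often in m and
    some y_b too rarely. As x_b y_b has the same joint degree in both, x_b divides m, and a minor
    trades y_a x_b for x_a y_b. The measure D is the total excess of y-exponents. *)
Lemma segre_swap l (m m' : 'X_{1..N}) :
  segre_mon l m = segre_mon l m' -> segre_deg l m = segre_deg l m' ->
  minors l ('X_[m] - 'X_[m']).
Proof.
pose D (m : 'X_{1..N}) := (\sum_a (m (yi a) - m' (yi a)))%N.
have [n] := ubnP (D m); elim: n m => // n IH m ltn hmon hdeg.
have monx a : (m (xi a) + (enum_val a \in l) * m (yi a) =
    m' (xi a) + (enum_val a \in l) * m' (yi a))%N.
  by move/mnmP: hmon => /(_ (xi a)); rewrite !mnmE (unsplitK (inl _)).
have mony a : enum_val a \notin l -> m (yi a) = m' (yi a).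
  move=> ha; move/mnmP: hmon => /(_ (yi a)); rewrite !mnmE (unsplitK (inr _)).
  by rewrite ha !mul1n.
have sumy : (\sum_a m (yi a) = \sum_a m' (yi a))%N.
  rewrite (bigID (fun a => enum_val a \in l)) [RHS](bigID (fun a => enum_val a \in l)) /=.
  congr addn; last by apply: eq_bigr => a; apply: mony.
  move: hdeg; rewrite /segre_deg [RHS]big_mkcond [LHS]big_mkcond /= => h.
  rewrite [LHS]big_mkcond [RHS]big_mkcond /=.
  transitivity (\sum_a (enum_val a \in l) * m (yi a))%N.
    by apply: eq_bigr => a _; case: ifP; rewrite ?mul1n ?mul0n.
  by rewrite h; apply: eq_bigr => a _; case: ifP; rewrite ?mul1n ?mul0n.
have [/existsP [a lta]|/existsPn none] := boolP [exists a, m' (yi a) < m (yi a)]%N;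
  last first.
  have le a : (m (yi a) <= m' (yi a))%N by rewrite leqNgt; apply: none.
  have eqy a : m (yi a) = m' (yi a).
    have := @leqif_sum _ predT _ _ _ (fun a _ => leqif_eq (le a)).
    by case=> _; rewrite sumy eqxx => /esym /forallP /(_ a) /eqP.
  suff -> : m = m' by rewrite subrr; apply: id0 (is_ideal_minors l).
  apply/mnmP => i; rewrite -[i]splitK; case: (split i) => a /=; last exact: eqy.
  by move: (monx a); rewrite eqy => /addIn.
have [/existsP [b ltb]|/existsPn none] := boolP [exists b, m (yi b) < m' (yi b)]%N;
  last first.
  have : (\sum_a m' (yi a) < \sum_a m (yi a))%N.
    rewrite [X in (X < _)%N](bigD1 a) // [X in (_ < X)%N](bigD1 a) //= -addSn leq_add //.
    by apply: leq_sum => c _; rewrite leqNgt; apply: none.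
  by rewrite sumy ltnn.
have la : enum_val a \in l by apply: contraTT lta => /mony ->; rewrite ltnn.
have lb : enum_val b \in l by apply: contraTT ltb => /mony ->; rewrite ltnn.
have xb : (0 < m (xi b))%N by move: (monx b); rewrite lb; lia.
have ab : a != b by apply: contraTneq lta => ->; rewrite -leqNgt ltnW.
pose r := (m - (U_(yi a) + U_(xi b)))%MM.
have mE : m = (r + (U_(yi a) + U_(xi b)))%MM.
  rewrite /r submK //; apply/mnm_lepP => i; rewrite mnmDE !mnm1E.
  case: (eqVneq (yi a) i) => [<-|_];
    first by rewrite eq_lrshift addn0 (leq_ltn_trans _ lta).
  by case: (eqVneq (xi b) i) => [<-|_].
pose m2 := (r + (U_(xi a) + U_(yi b)))%MM.
have m2y c : (m2 (yi c) + (c == a) = m (yi c) + (c == b))%N.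
  by rewrite [in RHS]mE /m2 !mnmDE !mnm1E !eq_lrshift !eq_rshift ![_ == c]eq_sym; lia.
have hm2 : minors l ('X_[m2] - 'X_[m']).
  apply: IH.
  - apply: leq_trans (_ : D m <= n)%N => //.
    rewrite /D (bigD1 a) // [X in (_ < X)%N](bigD1 a) //= -addSn leq_add //.
      move: (m2y a); rewrite eqxx (negPf ab).
      by move: lta; move: (m (yi a)) (m' (yi a)) (m2 (yi a)) => p q s; lia.
    apply: leq_sum => c ne; move: (m2y c); rewrite (negPf ne).
    case: (eqVneq c b) => [->|_]; last by move: (m _) (m2 _) => p q; lia.
    by move: ltb; move: (m _) (m' _) (m2 _) => p q s; lia.
  - by rewrite -hmon mE /m2 !segre_monD segre_mon_y // segre_mon_y // addmC addmC;
      congr (_ + _)%MM; rewrite addmC.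
  - by rewrite -hdeg mE /m2 !segre_degD !segre_deg_y // !segre_deg_x.
have -> : 'X_[m] - 'X_[m'] = 'X_[r] * minor (enum_val b) (enum_val a) +
    ('X_[m2] - 'X_[m']) :> S.
  rewrite mE /m2 !mpolyXD /minor /xvar /yvar !enum_valK; ring.
apply: idD => //; first exact: is_ideal_minors.
by apply: idM; [exact: is_ideal_minors | exact: minors_gen].
Qed.

(** If f maps to zero, the image of its leading monomial m must be cancelled by that of another
    monomial m' of f. Subtracting a multiple of X^m - X^m' removes m and adds nothing new to the
    support. *)
Lemma segre_ker l f : segre l f = 0 <-> minors l f.
Proof.
split; last first.
  apply: (@minors_min l (fun h => segre l h = 0)).
    split=> [|a b ha hb|c a ha]; first exact: rmorph0.
      by rewrite rmorphD /= ha hb addr0.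
    by rewrite rmorphM /= ha mulr0.
  by move=> u v hu hv; rewrite /minor rmorphB !rmorphM /= !segre_x !segre_y hu hv; ring.
have [n] := ubnP (size (msupp f)); elim: n f => // n IH f ltn f0.
case: (eqVneq f 0) => [->|fn0]; first exact: id0 (is_ideal_minors l).
pose m := mlead f.
have hm : m \in msupp f by apply: mlead_supp.
have := coef_segre l f m; rewrite f0 coef0 mcoeff0.
rewrite big_mkcond (big_rem m) //= !eqxx /= -big_mkcond /= => e.
have [/hasP [m' hm' /andP [/eqP e1 /eqP e2]]|/hasPn none] :=
  boolP (has (fun m' => (segre_mon l m' == segre_mon l m) &&
    (segre_deg l m' == segre_deg l m)) (rem m (msupp f))); last first.
  move: e; rewrite big1_seq ?addr0 => [/esym /eqP|m' /andP [h1 /none]]; last by rewrite h1.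
  by rewrite mcoeff_eq0 hm.
have ne : m' != m by move: hm';
  rewrite (rem_filter _ (msupp_uniq _)) mem_filter => /andP [].
have hm2 : m' \in msupp f by apply: mem_rem hm'.
pose g := f - f@_m *: ('X_[m] - 'X_[m']).
have sw : minors l ('X_[m] - 'X_[m']) by apply: segre_swap.
have -> : f = g + (f@_m)%:MP * ('X_[m] - 'X_[m']) by rewrite mul_mpolyC subrK.
apply: idD; [exact: is_ideal_minors | | by apply: idM => //; exact: is_ideal_minors].
apply: IH; last first.
  rewrite /g -mul_mpolyC rmorphB rmorphM /= f0 rmorphB /= !segre_monE e1 e2.
  by rewrite subrr mulr0 subrr.
have sub : {subset msupp g <= rem m (msupp f)}.
  move=> m1; rewrite (rem_filter _ (msupp_uniq _)) mem_filter /= !mcoeff_msupp.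
  rewrite mcoeffB mcoeffZ mcoeffB !mcoeffX.
  case: (eqVneq m m1) => [<-|ne1]; first by rewrite (negPf ne) subr0 mulr1 subrr eqxx.
  rewrite /=; case: (eqVneq m' m1) => [<- _|_]; last by rewrite subrr mulr0 subr0.
  by rewrite -mcoeff_msupp.
have := uniq_leq_size (msupp_uniq g) sub; rewrite size_rem //.
have : (0 < size (msupp f))%N by move: hm; case: (msupp f).
by move: ltn; move: (size (msupp f)) (size (msupp g)) => p q; lia.
Qed.

Lemma minors_prime l f g : minors l (f * g) -> minors l f \/ minors l g.
Proof.
move/segre_ker; rewrite rmorphM => /eqP; rewrite mulf_eq0.
by case/orP => /eqP /segre_ker; [left | right].
Qed.

End Segre.

(** * Nonzerodivisors and fresh variables *)

Section FreshVariables.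
Variables (k : fieldType) (N : nat).
Local Notation S := {mpoly k[N]}.
Implicit Types (Q L : S -> Prop) (i j : 'I_N).

Lemma mpoly_ring_ind (P : S -> Prop) :
  (forall c, P c%:MP) -> (forall i, P 'X_i) -> (forall a b, P a -> P b -> P (a + b)) ->
  (forall a b, P a -> P b -> P (a * b)) -> forall h, P h.
Proof.
move=> hC hX hD hM h; rewrite [h]mpolyE; elim/big_ind: _ => //.
  by rewrite -mpolyC0.
move=> m _; rewrite -mul_mpolyC; apply: (hM) => //; rewrite mpolyXE_id.
elim/big_ind: _ => // [|i _]; first by rewrite -mpolyC1.
by elim: (m i) => [|n IH]; [rewrite expr0 -mpolyC1 | rewrite exprS; apply: hM].
Qed.

(** The coefficient ring is S itself, not a ring in one variable fewer, so coefficients with respect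
    to X_i can be tested for membership in the same ideals. *)
Definition split_var i : S -> {poly S} :=
  mmap (@polyC S \o @mpolyC N k) (fun j => if j == i then 'X else ('X_j)%:P).

HB.instance Definition _ i := GRing.RMorphism.copy (split_var i)
  (mmap (@polyC S \o @mpolyC N k) (fun j => if j == i then 'X else ('X_j)%:P)).

Definition var_free i (a : S) := split_var i a = a%:P.

Definition var_coef i d (h : S) : S := (split_var i h)`_d.

(* Q is extended from the subring of polynomials not involving X_i. *)
Definition var_fresh i Q := forall h d, Q h -> Q (var_coef i d h).

Lemma split_varX i j : split_var i 'X_j = if j == i then 'X else ('X_j)%:P.
Proof. by rewrite /split_var mmapX mmap1U. Qed.

Lemma var_freeX i j : j != i -> var_free i 'X_j.
Proof. by move=> ne; rewrite /var_free split_varX (negPf ne). Qed.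

Lemma var_freeM i a b : var_free i a -> var_free i b -> var_free i (a * b).
Proof. by rewrite /var_free => ha hb; rewrite rmorphM /= ha hb rmorphM. Qed.

Lemma var_freeB i a b : var_free i a -> var_free i b -> var_free i (a - b).
Proof. by rewrite /var_free => ha hb; rewrite rmorphB /= ha hb rmorphB. Qed.

Lemma var_free0 i : var_free i 0.
Proof. by rewrite /var_free !rmorph0. Qed.

Lemma split_varK i h : (split_var i h).['X_i] = h.
Proof.
elim/mpoly_ring_ind: h => [c|j|a b ha hb|a b ha hb].
- by rewrite /split_var mmapC /= hornerC.
- by rewrite split_varX; case: eqP => [->|_]; rewrite ?hornerX ?hornerC.
- rewrite [split_var i _]rmorphD.
  exact: etrans (hornerD (split_var i a) (split_var i b) 'X_i) (congr2 +%R ha hb).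
- rewrite [split_var i _]rmorphM.
  exact: etrans (hornerM (split_var i a) (split_var i b) 'X_i) (congr2 *%R ha hb).
Qed.

Lemma var_coefD i d a b : var_coef i d (a + b) = var_coef i d a + var_coef i d b.
Proof. by rewrite /var_coef [split_var i _]rmorphD; apply: coefD. Qed.

Lemma var_coefN i d a : var_coef i d (- a) = - var_coef i d a.
Proof. by rewrite /var_coef [split_var i _]rmorphN; apply: coefN. Qed.

Lemma var_coef0 i d : var_coef i d 0 = 0.
Proof. by rewrite /var_coef [split_var i _]rmorph0; apply: coef0. Qed.

Lemma var_coef_free i d a b : var_free i a -> var_coef i d (a * b) = a * var_coef i d b.
Proof.
by move=> ha; rewrite /var_coef [split_var i _]rmorphM /= ha; apply: coefCM.
Qed.

Lemma var_coefXS i d a : var_coef i d.+1 ('X_i * a) = var_coef i d a.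
Proof.
rewrite /var_coef [split_var i _]rmorphM /= split_varX eqxx.
by apply: etrans (coefXM (split_var i a) d.+1) _.
Qed.

Lemma var_coefX0 i a : var_coef i 0 ('X_i * a) = 0.
Proof.
rewrite /var_coef [split_var i _]rmorphM /= split_varX eqxx.
by apply: etrans (coefXM (split_var i a) 0) _.
Qed.

Lemma var_coef_id Q i h : is_ideal Q -> (forall d, Q (var_coef i d h)) -> Q h.
Proof.
move=> iQ hd; rewrite -[h](split_varK i) horner_coef.
by apply: id_sum => // d _; exact: idMr iQ (hd d).
Qed.

Lemma var_coef_rem i h : exists h', h = var_coef i 0 h + 'X_i * h'.
Proof.
exists (\sum_(d < size (split_var i h)) var_coef i d.+1 h * 'X_i ^+ d).
rewrite -[LHS](split_varK i) (horner_coef_wide (n := (size (split_var i h)).+1)) //.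
rewrite big_ord_recl expr0 mulr1 mulr_sumr; congr (_ + _).
by apply: eq_bigr => d _; rewrite lift0 exprS mulrCA.
Qed.

Lemma var_fresh_comb i s Q : var_fresh i Q -> is_ideal Q ->
  (forall f, f \in s -> var_free i f) ->
  var_fresh i (comb s Q unit_ideal).
Proof.
move=> fQ iQ; elim: s => //= f s IH hs _ d [a [c [ha _ ->]]].
exists (var_coef i d a), (var_coef i d c); split=> //.
  by apply: IH => // g hg; apply: hs; rewrite inE hg orbT.
by rewrite var_coefD var_coef_free //; apply: hs; rewrite mem_head.
Qed.

Lemma var_fresh_zero i : var_fresh i zero_ideal.
Proof. by move=> _ d ->; rewrite /zero_ideal var_coef0. Qed.

Lemma nz_var Q i : is_ideal Q -> var_fresh i Q -> nz Q 'X_i.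
Proof.
move=> iQ fQ g _ hg; apply: (var_coef_id (i := i)) => // d.
by move: (fQ _ d.+1 hg); rewrite var_coefXS.
Qed.

Lemma nzN Q f : nz Q f -> is_ideal Q -> nz Q (- f).
Proof.
by move=> h iQ g _ hg; apply: h => //; rewrite -[f * g]opprK -mulNr; apply: idN.
Qed.

Lemma nzM Q f g : nz Q f -> nz Q g -> nz Q (f * g).
Proof. by move=> hf hg h _; rewrite -mulrA => /(hf _ I) /(hg _ I). Qed.

(** With g_d the coefficients of g in X_i, the coefficient of X_i^(d+1) in the product gives a g_d -
    b g_(d+1) in Q. Descending from above the top degree, g_(d+1) in Q implies a g_d in Q, hence g_d
    in Q. *)
Lemma nz_edge Q i a b : is_ideal Q -> var_fresh i Q -> var_free i a -> var_free i b ->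
  nz Q a ->
  nz Q (a * 'X_i - b).
Proof.
move=> iQ fQ ha hb nza g _ hg; apply: (var_coef_id (i := i)) => //.
have rec d : Q (a * var_coef i d g - b * var_coef i d.+1 g).
  move: (fQ _ d.+1 hg).
  by rewrite mulrBl -mulrA var_coefD var_coefN (var_coef_free _ _ ha)
    (var_coef_free _ _ hb) var_coefXS.
suff main n d : (size (split_var i g) <= d + n)%N -> Q (var_coef i d g).
  by move=> d; apply: (main (size (split_var i g))); rewrite leq_addl.
elim: n d => [|n IH] d.
  by rewrite addn0 => le; rewrite /var_coef nth_default //; apply: id0.
rewrite addnS -addSn => /IH hd; apply: nza => //.
rewrite -[a * _](subrK (b * var_coef i d.+1 g)); apply: idD => //; exact: idM.
Qed.

(** Let X_j g = q + f h, with f the binomial. Setting X_j to zero gives a X_i h_0 in Q, hence h_0 in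
    Q; with h = h_0 + X_j h' this leaves X_j (g - f h') in Q. So the new end of a path again carries
    a regular variable. *)
Lemma nz_tip Q i j a b : is_ideal Q -> var_fresh i Q -> var_fresh j Q -> i != j ->
  var_free j a -> nz Q a ->
  nz (comb [:: a * 'X_i - b * 'X_j] Q unit_ideal) 'X_j.
Proof.
move=> iQ fi fj ij ha nza g _ [q [h [hq _ E]]].
have hh0 : Q (var_coef j 0 h).
  have := congr1 (var_coef j 0) E; rewrite var_coefX0 mulrBl var_coefD addrC.
  rewrite var_coefD -[b * 'X_j * h]mulrA [b * _]mulrCA var_coefN var_coefX0 oppr0 addr0.
  rewrite var_coef_free; last exact: var_freeM ha (var_freeX ij).
  move=> /esym /eqP; rewrite addr_eq0 -mulrA => /eqP e.
  apply: (nz_var iQ fi) => //; apply: nza => //.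
  by rewrite e; apply: idN => //; apply: fj.
have [h' hE] := var_coef_rem j h.
set f := a * 'X_i - b * 'X_j in E *.
exists (g - f * h'), h'; split=> //; last by rewrite subrK.
apply: (nz_var iQ fj) => //.
have -> : 'X_j * (g - f * h') = q + f * var_coef j 0 h.
  by rewrite mulrBr E {1}hE; ring.
by apply: idD => //; apply: idM.
Qed.

(** The half of permuting a regular sequence z, f that needs no local hypothesis: z remains regular
    modulo f. *)
Lemma nz_swap Q z f : is_ideal Q -> nz Q z ->
  nz (comb [:: z] Q unit_ideal) f -> nz (comb [:: f] Q unit_ideal) z.
Proof.
move=> iQ nzz nzf g _ [q [h [hq _ E]]].
have [q' [c [hq' _ hE]]] : comb [:: z] Q unit_ideal h.
  apply: nzf => //; exists (- q), g; split=> //; first exact: idN.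
  by rewrite E; ring.
exists (g - f * c), c; split=> //; last by rewrite subrK.
apply: nzz => //; have -> : z * (g - f * c) = q + f * q' by rewrite mulrBr E hE; ring.
by apply: idD => //; apply: idM.
Qed.

Lemma nzd_ext (R : comNzRingType) (M Q Q' : R -> Prop) f :
  (forall h, Q h <-> Q' h) -> nzd M Q f -> nzd M Q' f.
Proof. by move=> e n g hg /e hh; apply/e; apply: n. Qed.

Lemma comb_perm (R : comNzRingType) (Q : R -> Prop) s1 s2 h : is_ideal Q -> s1 =i s2 ->
  comb s1 Q unit_ideal h <-> comb s2 Q unit_ideal h.
Proof. by move=> iQ e; split; apply: comb_sub => // x; rewrite e. Qed.

Lemma nz_preserved Q z s : is_ideal Q -> nz Q z ->
  regular s (comb [:: z] Q unit_ideal) unit_ideal -> nz (comb s Q unit_ideal) z.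
Proof.
move=> iQ nzz; elim: s => //= f s IH [/IH nzs nzf].
apply: (@nz_swap (comb s Q unit_ideal)) => //; first exact: is_ideal_comb.
apply: nzd_ext nzf => h.
rewrite -[comb s (comb [:: z] Q unit_ideal) unit_ideal]comb_cat.
rewrite -[comb [:: z] (comb s Q unit_ideal) unit_ideal]comb_cat.
by apply: comb_perm => // x; rewrite mem_cat inE orbC.
Qed.

Definition kill (A : pred 'I_N) : S -> S :=
  mmap (@mpolyC N k) (fun i => if A i then 0 else 'X_i).

HB.instance Definition _ A := GRing.RMorphism.copy (kill A)
  (mmap (@mpolyC N k) (fun i => if A i then 0 else 'X_i)).

Lemma killX A i : kill A 'X_i = if A i then 0 else 'X_i.
Proof. by rewrite /kill mmapX mmap1U. Qed.

Lemma kill_idem A h : kill A (kill A h) = kill A h.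
Proof.
elim/mpoly_ring_ind: h => [c|j|a b ha hb|a b ha hb].
- by rewrite /kill !mmapC.
- by rewrite killX; case: ifP => [_|h]; rewrite ?rmorph0 // killX h.
- by rewrite !rmorphD /= ha hb.
- by rewrite !rmorphM /= ha hb.
Qed.

Lemma kill_sub (A : pred 'I_N) L h : is_ideal L -> (forall i, A i -> L 'X_i) ->
  L (h - kill A h).
Proof.
move=> iL hA; elim/mpoly_ring_ind: h => [c|j|a b ha hb|a b ha hb].
- by rewrite /kill mmapC subrr; apply: id0.
- by rewrite killX; case: ifP => [/hA|_]; rewrite ?subr0 // subrr; apply: id0.
- by rewrite rmorphD /= opprD addrACA; apply: idD.
- rewrite rmorphM /=; have -> : a * b - kill A a * kill A b =
    b * (a - kill A a) + kill A a * (b - kill A b) by ring.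
  by apply: idD => //; apply: idM.
Qed.

Lemma is_ideal_comap (R R' : comNzRingType) (f : {rmorphism R -> R'}) (L : R' -> Prop) :
  is_ideal L -> is_ideal (fun h => L (f h)).
Proof.
move=> iL; split=> [|a b ha hb|c a ha].
- by rewrite rmorph0; apply: id0.
- by rewrite rmorphD; apply: idD.
- by rewrite rmorphM; apply: idM.
Qed.

Lemma is_ideal_colon (R : comNzRingType) (z : R) (L : R -> Prop) :
  is_ideal L -> is_ideal (fun h => L (z * h)).
Proof.
move=> iL; split=> [|a b ha hb|c a ha].
- by rewrite mulr0; apply: id0.
- by rewrite mulrDr; apply: idD.
- by rewrite mulrCA; apply: idM.
Qed.

End FreshVariables.

(** * Attaching paths to a complete graph *)

Section PathRegularity.
Variables (k : fieldType) (T : finType).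
Local Notation N := (#|T| + #|T|)%N.
Local Notation S := {mpoly k[N]}.
Local Notation xv := (@xvar k T).
Local Notation yv := (@yvar k T).
Implicit Types (Q : S -> Prop) (u v w x : T) (l p : seq T).

Definition xidx v : 'I_N := lshift #|T| (enum_rank v).
Definition yidx v : 'I_N := rshift #|T| (enum_rank v).

Lemma xidx_eq u v : (xidx u == xidx v) = (u == v).
Proof. by rewrite eq_lshift (inj_eq enum_rank_inj). Qed.

Lemma yidx_eq u v : (yidx u == yidx v) = (u == v).
Proof. by rewrite eq_rshift (inj_eq enum_rank_inj). Qed.

Lemma xyidx_neq u v : (xidx u == yidx v) = false.
Proof. exact: eq_lrshift. Qed.

Lemma yxidx_neq u v : (yidx u == xidx v) = false.
Proof. exact: eq_rlshift. Qed.

Definition edge u v : S := xv u * xv v - yv u * yv v.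

Definition vfree w (f : S) := var_free (xidx w) f /\ var_free (yidx w) f.
Definition vfresh w Q := var_fresh (xidx w) Q /\ var_fresh (yidx w) Q.

Lemma vfree_xv w u : w != u -> vfree w (xv u).
Proof.
move=> ne; split; apply: var_freeX; first by rewrite -/(xidx u) xidx_eq eq_sym.
by rewrite -/(xidx u) xyidx_neq.
Qed.

Lemma vfree_yv w u : w != u -> vfree w (yv u).
Proof.
move=> ne; split; apply: var_freeX; last by rewrite -/(yidx u) yidx_eq eq_sym.
by rewrite -/(yidx u) yxidx_neq.
Qed.

Lemma vfree_edge w u v : w != u -> w != v -> vfree w (edge u v).
Proof.
move=> wu wv; have [x1 x2] := vfree_xv wu; have [x3 x4] := vfree_xv wv.
have [y1 y2] := vfree_yv wu; have [y3 y4] := vfree_yv wv.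
by split; apply: var_freeB; apply: var_freeM.
Qed.

Lemma vfree_minor w u v : w != u -> w != v -> vfree w (minor k u v).
Proof.
move=> wu wv; have [x1 x2] := vfree_xv wu; have [x3 x4] := vfree_xv wv.
have [y1 y2] := vfree_yv wu; have [y3 y4] := vfree_yv wv.
by split; apply: var_freeB; apply: var_freeM.
Qed.

Lemma vfresh_comb w s Q : vfresh w Q -> is_ideal Q -> (forall f, f \in s -> vfree w f) ->
  vfresh w (comb s Q unit_ideal).
Proof.
by move=> [h1 h2] iQ hs; split; apply: var_fresh_comb => // f /hs [].
Qed.

Lemma vfresh_zero w : vfresh w zero_ideal.
Proof. by split; apply: var_fresh_zero. Qed.

Lemma vfresh_minors w l : w \notin l -> vfresh w (minors l).
Proof.
move=> hw; apply: vfresh_comb; [exact: vfresh_zero | exact: is_ideal_zero |].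
move=> _ /allpairsP [[u v] [/= hu hv ->]]; apply: vfree_minor.
  by apply: contraNneq hw => ->.
by apply: contraNneq hw => ->.
Qed.

Lemma nz_xv Q v : is_ideal Q -> vfresh v Q -> nz Q (xv v).
Proof. by move=> iQ [h _]; apply: nz_var. Qed.

Lemma nz_yv Q v : is_ideal Q -> vfresh v Q -> nz Q (yv v).
Proof. by move=> iQ [_ h]; apply: nz_var. Qed.

(** The regular variable alternates along a path: if x_u is regular, x_w serves as the fresh
    variable X of the edge and y_w is regular afterwards; if y_u is, the roles of x and y are
    exchanged. Hence the disjunction. *)
Lemma edge_regular Q u w : is_ideal Q -> vfresh w Q -> u != w ->
  nz Q (xv u) \/ nz Q (yv u) ->
  nz Q (edge u w) /\ (nz (comb [:: edge u w] Q unit_ideal) (xv w) \/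
                      nz (comb [:: edge u w] Q unit_ideal) (yv w)).
Proof.
move=> iQ [fx fy] uw; have wu : w != u by rewrite eq_sym.
have [x1 x2] := vfree_xv wu; have [y1 y2] := vfree_yv wu.
case=> h; split.
- apply: nz_edge => //; apply: var_freeM => //.
  by apply: var_freeX; rewrite -/(yidx w) -/(xidx w) yxidx_neq.
- right; apply: nz_tip => //.
  by rewrite -/(yidx w) -/(xidx w) xyidx_neq.
- rewrite /edge -opprB; apply: nzN => //; apply: nz_edge => //; apply: var_freeM => //.
  by apply: var_freeX; rewrite -/(yidx w) -/(xidx w) xyidx_neq.
left; have : nz (comb [:: yv u * yv w - xv u * xv w] Q unit_ideal) (xv w).
  by apply: nz_tip => //; rewrite -/(yidx w) -/(xidx w) yxidx_neq.
apply: nzd_ext => f; split=> -[a [c [ha _ ->]]]; exists a, (- c); split=> //;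
  rewrite /edge; ring.
Qed.

(** The edge at x stands last in the list, so under the convention of [regular] it is adjoined
    first. *)
Fixpoint path_gens x p : seq S :=
  if p is y :: p' then rcons (path_gens y p') (edge x y) else [::].

Lemma path_gens_edge x p f : f \in path_gens x p ->
  exists u v, [/\ u \in x :: p, v \in p & f = edge u v].
Proof.
elim: p x => [|y p IH] x //=; rewrite mem_rcons inE => /predU1P [->|/IH].
  by exists x, y; rewrite !inE !eqxx.
by move=> [u [v [hu hv ->]]]; exists u, v; split=> //; rewrite inE ?hu ?hv orbT.
Qed.

Lemma path_gens_vfree w x p f : w \notin x :: p -> f \in path_gens x p -> vfree w f.
Proof.
move=> hw /path_gens_edge [u [v [hu hv ->]]].
by apply: vfree_edge; apply: contraNneq hw => -> //; rewrite inE hv orbT.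
Qed.

Lemma path_regular Q x p : is_ideal Q -> uniq (x :: p) ->
  (forall w, w \in p -> vfresh w Q) -> nz Q (xv x) \/ nz Q (yv x) ->
  regular (path_gens x p) Q unit_ideal.
Proof.
elim: p x Q => [|y p IH] x Q iQ //= /and3P [nx ny un] fr tip.
have xy : x != y by apply: contraNneq nx => ->; rewrite mem_head.
have [h1 h2] := edge_regular iQ (fr y (mem_head _ _)) xy tip.
rewrite -cats1 regular_cat; split=> //; apply: IH => //; first exact: is_ideal_comb.
  by rewrite /= ny.
move=> w hw; apply: vfresh_comb => //; first by apply: fr; rewrite inE hw orbT.
move=> _ /[1!inE] /eqP ->; apply: vfree_edge.
  by apply: contraNneq nx => <-; rewrite inE hw orbT.
by apply: contraNneq ny => <-.
Qed.

(** The path is regular over Q + (z), and z can then be moved past it one edge at a time. *)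
Lemma path_preserves Q z x p : is_ideal Q -> nz Q z -> uniq (x :: p) ->
  (forall w, w \in p -> vfresh w Q /\ vfree w z) ->
  nz (comb [:: z] Q unit_ideal) (xv x) \/ nz (comb [:: z] Q unit_ideal) (yv x) ->
  nz (comb (path_gens x p) Q unit_ideal) z.
Proof.
move=> iQ nzz un fr tip; apply: nz_preserved => //; apply: path_regular => //.
  exact: is_ideal_comb.
by move=> w /fr [h1 h2]; apply: vfresh_comb => // f /[1!inE] /eqP ->.
Qed.

Definition paths_gens (ps : seq (T * seq T)) : seq S :=
  flatten [seq path_gens q.1 q.2 | q <- ps].

Definition paths_verts (ps : seq (T * seq T)) : seq T :=
  flatten [seq q.1 :: q.2 | q <- ps].

Lemma paths_gens_vfree w ps f : w \notin paths_verts ps -> f \in paths_gens ps -> vfree w f.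
Proof.
move=> hw /flatten_mapP [q hq]; apply: path_gens_vfree.
by apply: contraNN hw => h; apply/flatten_mapP; exists q.
Qed.

Lemma paths_regular0 ps : uniq (paths_verts ps) ->
  regular (paths_gens ps) zero_ideal unit_ideal.
Proof.
elim: ps => [|[x p] ps IH] //; rewrite /paths_verts [map _ _]/= [flatten _]/=.
rewrite -cat_cons cat_uniq => /and3P [un /hasPn dis /IH reg].
rewrite /paths_gens [map _ _]/= [flatten _]/= regular_cat; split=> //.
have fr w : w \in x :: p -> vfresh w (comb (paths_gens ps) zero_ideal unit_ideal).
  move=> hw; apply: vfresh_comb; [exact: vfresh_zero | exact: is_ideal_zero |] => f.
  by apply: paths_gens_vfree; apply/negP => /dis /=; rewrite hw.
have iQ : is_ideal (comb (paths_gens ps) zero_ideal unit_ideal).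
  by apply: is_ideal_comb => //; apply: is_ideal_zero.
apply: path_regular => //; first by move=> w hw; apply: fr; rewrite inE hw orbT.
by left; apply: nz_xv => //; apply: fr; rewrite mem_head.
Qed.

(** Reduction modulo (x_u : u in l), a prime containing J and x_v for v in l, realised as an
    endomorphism of S. *)
Definition kill_x l : S -> S := kill (fun i => i \in [seq xidx u | u <- l]).
HB.instance Definition _ l := GRing.RMorphism.copy (kill_x l)
  (kill (fun i => i \in [seq xidx u | u <- l])).

Lemma kill_x_xv l u : kill_x l (xv u) = if u \in l then 0 else xv u.
Proof.
rewrite /kill_x /xvar killX -/(xidx u) mem_map // => a b /eqP.
by rewrite xidx_eq => /eqP.
Qed.

Lemma kill_x_yv l u : kill_x l (yv u) = yv u.
Proof.
rewrite /kill_x /yvar killX -/(yidx u); case: ifP => // /mapP [a _ /eqP].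
by rewrite yxidx_neq.
Qed.

Lemma kill_x_minor l u v : u \in l -> v \in l -> kill_x l (minor k u v) = 0.
Proof. by move=> hu hv; rewrite rmorphB !rmorphM /= !kill_x_xv hu hv !mul0r subrr. Qed.

Lemma kill_x_edge l u v : u \notin l -> v \notin l -> kill_x l (edge u v) = edge u v.
Proof.
by move=> hu hv; rewrite rmorphB !rmorphM /= !kill_x_xv !kill_x_yv (negPf hu) (negPf hv).
Qed.

Lemma vfree_kill_x l w u v : w != u -> w != v -> vfree w (kill_x l (edge u v)).
Proof.
move=> wu wv; rewrite rmorphB !rmorphM /= !kill_x_xv !kill_x_yv.
have [x1 x2] := vfree_xv wu; have [x3 x4] := vfree_xv wv.
have [y1 y2] := vfree_yv wu; have [y3 y4] := vfree_yv wv.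
by split; apply: var_freeB; apply: var_freeM => //; case: ifP => // _; apply: var_free0.
Qed.

Lemma paths_gens_kill_x_vfree l w ps f : w \notin paths_verts ps ->
  f \in [seq kill_x l g | g <- paths_gens ps] -> vfree w f.
Proof.
move=> hw /mapP [_ /flatten_mapP [q hq /path_gens_edge [u [v [hu hv ->]]]] ->].
apply: vfree_kill_x; apply: contraNneq hw => ->; apply/flatten_mapP; exists q => //.
by rewrite inE hv orbT.
Qed.

(** Reduction modulo (x_v, y_v). It maps J into itself and fixes every edge away from v. *)
Definition kill_vertex v : S -> S := kill (pred2 (xidx v) (yidx v)).
HB.instance Definition _ v := GRing.RMorphism.copy (kill_vertex v)
  (kill (pred2 (xidx v) (yidx v))).

Lemma kill_vertex_xv v u : kill_vertex v (xv u) = if u == v then 0 else xv u.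
Proof. by rewrite /kill_vertex /xvar killX /= -/(xidx u) xidx_eq xyidx_neq orbF. Qed.

Lemma kill_vertex_yv v u : kill_vertex v (yv u) = if u == v then 0 else yv u.
Proof. by rewrite /kill_vertex /yvar killX /= -/(yidx u) yidx_eq yxidx_neq. Qed.

Lemma kill_vertex_edge v u w : u != v -> w != v -> kill_vertex v (edge u w) = edge u w.
Proof.
move=> hu hw; rewrite rmorphB !rmorphM /= !kill_vertex_xv !kill_vertex_yv.
by rewrite (negPf hu) (negPf hw).
Qed.

(* Modulo J + (x_v), multiplication by y_v annihilates every x_u, u in l. *)
Lemma yv_kill_x_sub l v h : v \in l ->
  comb [:: xv v] (minors l) unit_ideal (yv v * (h - kill_x l h)).
Proof.
move=> hv; have iE : is_ideal (comb [:: xv v] (minors l) unit_ideal).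
  by apply: is_ideal_comb => //; apply: is_ideal_minors.
have iC := is_ideal_colon (yv v) iE.
apply: (@kill_sub _ _ _ _ h iC) => i /mapP [u hu ->].
exists (- minor k v u), (yv u); split=> //.
  by apply: idN; [exact: is_ideal_minors | exact: minors_gen].
rewrite -[X in _ * X]/(xv u) /minor; ring.
Qed.

(* If x_v g lies in J + paths + (f), f the edge from u in K to the fresh
   vertex w, grading by v makes the cofactor of f a multiple of x_v or y_v, and
   in the latter case setting all x_u to 0 shows that it lies in
   J + paths + (x_v). *)
Lemma attach_preserves l ps u w p v :
  v \in l -> u \in l -> uniq (paths_verts ((u, w :: p) :: ps)) ->
  (forall q a, q \in ps -> a \in q.2 -> a \notin l) ->
  (forall a, a \in w :: p -> a \notin l) ->
  v \notin paths_verts ((u, w :: p) :: ps) ->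
  nz (comb (paths_gens ps) (minors l) unit_ideal) (xv v) ->
  nz (comb (paths_gens ((u, w :: p) :: ps)) (minors l) unit_ideal) (xv v).
Proof.
move=> vl ul; rewrite {1 2}/paths_verts [map _ _]/= [flatten _]/=.
rewrite -2!cat_cons cat_uniq -/(paths_verts ps) => /and3P [un /hasPn dis unps] psl pl.
rewrite mem_cat negb_or => /andP [vp vps] nzv.
have iJ := @is_ideal_minors k T l.
set Q1 := comb (paths_gens ps) (minors l) unit_ideal in nzv.
have iQ1 : is_ideal Q1 by apply: is_ideal_comb.
have dis' a : a \in [:: u, w & p] -> a \notin paths_verts ps.
  by move=> ha; apply/negP => /dis /=; rewrite ha.
have fr1 a : a \in w :: p -> vfresh a Q1.
  move=> ha; apply: vfresh_comb => //; first exact: vfresh_minors (pl _ ha).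
  by move=> f; apply: paths_gens_vfree; apply: dis'; rewrite inE ha orbT.
have [nu unwp] := andP un.
(* All generators except the edge from u to w. Without that edge the rest of the new path is
   detached from K, so x_v is easily seen to be regular modulo [Q2]. *)
set s := path_gens w p ++ paths_gens ps; set Q2 := comb s (minors l) unit_ideal.
have iQ2 : is_ideal Q2 by apply: is_ideal_comb.
have vw a : a \in w :: p -> a != v.
  by move=> ha; apply: contraNneq vp => <-; rewrite inE ha orbT.
have vu : u != v by apply: contraNneq vp => <-; rewrite mem_head.
have nz2 : nz Q2 (xv v).
  rewrite /Q2 /s comb_cat; apply: path_preserves => //.
    by move=> a ha; split; [apply: fr1 | apply: vfree_xv; apply: vw]; rewrite inE ha orbT.
  left; apply: nz_xv; first exact: is_ideal_comb.
  apply: vfresh_comb => //; first by apply: fr1; rewrite mem_head.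
  by move=> f /[1!inE] /eqP ->; apply: vfree_xv; apply: vw; rewrite mem_head.
have gens_edge f : f \in s -> exists a b, [/\ a != v, b != v, b \notin l & f = edge a b].
  rewrite mem_cat => /orP [/path_gens_edge [a [b [ha hb ->]]]|].
    exists a, b; split=> //; [exact: vw | apply: vw | apply: pl];
    by rewrite inE hb orbT.
  move=> /flatten_mapP [q hq /path_gens_edge [a [b [ha hb ->]]]].
  have hv c : c \in q.1 :: q.2 -> c != v.
    by move=> hc; apply: contraNneq vps => <-; apply/flatten_mapP; exists q.
  exists a, b; split=> //; [exact: hv | by apply: hv;
    rewrite inE hb orbT | exact: psl hq hb].
set f := edge u w.
have wl : w \notin l by apply: pl; rewrite mem_head.
have wv : w != v by apply: vw; rewrite mem_head.
have sig h : Q2 h -> Q2 (kill_vertex v h).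
  apply: (@comb_min _ _ _ _ (fun h => Q2 (kill_vertex v h))) => [|{}h hh|g c hg _].
  - exact: is_ideal_comap iQ2.
  - apply: comb_base => //; move: h hh.
    apply: (@minors_min _ _ _ (fun h => minors l (kill_vertex v h)));
      first exact: is_ideal_comap iJ.
    move=> a b ha hb; rewrite rmorphB !rmorphM /= !kill_vertex_xv !kill_vertex_yv.
    case: (eqVneq a v) => _; case: (eqVneq b v) => _;
      rewrite ?mul0r ?mulr0 ?subrr; try exact: id0 iJ.
    exact: minors_gen.
  - have [a [b [av bv _ E]]] := gens_edge g hg.
    by rewrite rmorphM /= E kill_vertex_edge // -E; apply: comb_gen.
(* The generators of [Q2] after setting x_u = 0 on K: J disappears, the tail of the new path is
   unchanged, and an edge of another path at K may lose its x-term. Below, [killE] maps E into [Q0],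
   and [yE] goes back at the cost of a factor y_v. *)
pose s0 := path_gens w p ++ [seq kill_x l g | g <- paths_gens ps].
pose Q0 := comb s0 (zero_ideal : S -> Prop) unit_ideal.
have iz : is_ideal (zero_ideal : S -> Prop) by apply: is_ideal_zero.
have iQ0 : is_ideal Q0 by apply: is_ideal_comb.
pose E := comb [:: xv v] Q2 unit_ideal.
have iE : is_ideal E by apply: is_ideal_comb.
have kill_x_path g : g \in path_gens w p -> kill_x l g = g.
  by move=> /path_gens_edge [a [b [ha hb ->]]]; apply: kill_x_edge; apply: pl;
    rewrite // inE hb orbT.
have killE h : E h -> Q0 (kill_x l h).
  move=> [q [c [hq _ ->]]]; rewrite rmorphD rmorphM /= kill_x_xv vl mul0r addr0.
  apply: (@comb_min _ _ _ _ (fun h => Q0 (kill_x l h))) hq => [|{}h hh|g {}c hg _].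
  - exact: is_ideal_comap iQ0.
  - suff -> : kill_x l h = 0 by apply: id0.
    move: h hh; apply: (@minors_min _ _ _ (fun h => kill_x l h = 0)).
      exact: is_ideal_comap iz.
    by move=> a b; apply: kill_x_minor.
  - rewrite rmorphM /=; apply: comb_gen => //; move: hg; rewrite !mem_cat => /orP [hg|hg].
      by rewrite kill_x_path ?hg.
    by rewrite map_f ?orbT.
have EyJ h : comb [:: xv v] (minors l) unit_ideal h -> E h.
  by move=> [q [c [hq _ ->]]]; exists q, c; split=> //; exact: (@comb_base _ s).
have Q2gen g : g \in s -> Q2 g by move=> hg; rewrite -[g]mulr1; apply: comb_gen.
have yE h : Q0 h -> E (yv v * h).
  apply: (@comb_min _ _ _ _ (fun h => E (yv v * h))) => [|_ ->|g c hg _].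
  - exact: is_ideal_colon.
  - by rewrite mulr0; apply: id0.
  rewrite mulrA; apply: idMr => //; move: hg; rewrite mem_cat => /orP [hg|].
    apply: idM => //; exists g, 0; split=> //; last by rewrite mulr0 addr0.
    by apply: Q2gen; rewrite mem_cat hg.
  move=> /mapP [g' hg' ->].
  have -> : yv v * kill_x l g' = yv v * g' - yv v * (g' - kill_x l g') by ring.
  apply: idB => //; last by apply: EyJ; apply: yv_kill_x_sub.
  apply: idM => //; exists g', 0; split=> //; last by rewrite mulr0 addr0.
  by apply: Q2gen; rewrite mem_cat hg' orbT.
have frt a : a \notin paths_verts ps ->
    vfresh a (comb [seq kill_x l g | g <- paths_gens ps] zero_ideal unit_ideal).
  move=> ha; apply: vfresh_comb => //; first exact: vfresh_zero.
  by move=> g; apply: paths_gens_kill_x_vfree.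
have iT : is_ideal (comb [seq kill_x l g | g <- paths_gens ps] zero_ideal unit_ideal).
  exact: is_ideal_comb.
have fr0 a : a \notin paths_verts ps -> a \notin w :: p -> vfresh a Q0.
  move=> ha hap; rewrite /Q0 comb_cat; apply: vfresh_comb => //; first exact: frt.
  by move=> g; apply: path_gens_vfree.
have nzY : nz Q0 (yv w).
  rewrite /Q0 comb_cat; have ww : w \notin paths_verts ps.
    by apply: dis'; rewrite !inE eqxx orbT.
  apply: path_preserves => //; first by apply: nz_yv => //; apply: frt.
    move=> a ha; split; first by apply: frt; apply: dis'; rewrite !inE ha !orbT.
    by apply: vfree_yv; apply: contraTneq unwp => <-; rewrite /= ha.
  left; apply: nz_var; first exact: is_ideal_comb.
  apply: var_fresh_comb => //; first by case: (frt _ ww).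
  by move=> g /[1!inE] /eqP ->; apply: var_freeX; rewrite -/(yidx w) -/(xidx w) yxidx_neq.
have nz0 : nz Q0 (- (yv u * yv w) * yv v).
  rewrite mulNr; apply: nzN => //; apply: nzM.
    apply: nzM => //; apply: nz_yv => //; apply: fr0; last exact: nu.
    by apply: dis'; rewrite mem_head.
  by apply: nz_yv => //; apply: fr0 => //; apply: contraNN vp => h; rewrite inE h orbT.
(* Setting x_u = 0 turns f into - y_u y_w, which is regular modulo [Q0]; so f can be cancelled
   modulo E from multiples of y_v. *)
have key b : E (f * (yv v * b)) -> E (yv v * b).
  move=> h; have h2 : E (f * (yv v * kill_x l b)).
    rewrite (_ : f * _ = f * (yv v * b) - f * (yv v * (b - kill_x l b))); last by ring.
    by apply: idB => //; apply: idM => //; apply: EyJ; apply: yv_kill_x_sub.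
  have := killE _ h2; rewrite rmorphM rmorphM /= rmorphB !rmorphM /= !kill_x_yv
    !kill_x_xv ul.
  rewrite /kill_x kill_idem -/(kill_x l) mul0r sub0r mulrA => /(nz0 _ I) /yE h3.
  by rewrite -[yv v * b](subrK (yv v * kill_x l b)) -mulrBr; apply: idD => //;
    apply: EyJ; apply: yv_kill_x_sub.
suff main : nz (comb (f :: s) (minors l) unit_ideal) (xv v).
  apply: nzd_ext main => h; apply: comb_perm => // g.
  by rewrite /paths_gens /= mem_cat mem_rcons !inE mem_cat orbA.
move=> g _ [q [h [hq _ gE]]].
(* Setting x_v and y_v to zero kills x_v g, fixes f and preserves [Q2], which disposes of the part
   of h free of v. *)
have hs : Q2 (f * kill_vertex v h).
  have := congr1 (kill_vertex v) gE; rewrite rmorphD !rmorphM /= kill_vertex_xv eqxx mul0r.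
  rewrite [kill_vertex v f]kill_vertex_edge // => /esym /eqP;
    rewrite addrC addr_eq0 => /eqP ->.
  by apply: idN => //; apply: sig.
have [_ [b [[_ [a [-> _ ->]]] _ hE]]] :
    comb [:: yv v; xv v] zero_ideal unit_ideal (h - kill_vertex v h).
  apply: kill_sub; first exact: is_ideal_comb.
  move=> i /orP [] /eqP ->.
    by exists (xv v), 0; split=> //; [exists 0, 1; split=> //;
      rewrite add0r mulr1 | rewrite mulr0 addr0].
  by exists 0, 1; split=> //; [exact: id0 (is_ideal_comb _ _ _) | rewrite add0r mulr1].
have hE' : h = kill_vertex v h + xv v * a + yv v * b.
  by rewrite -[LHS](subrK (kill_vertex v h)) hE; ring.
have [q' [c [hq' _ yb]]] : E (yv v * b).
  apply: key; exists (- q - f * kill_vertex v h), (g - f * a); split=> //.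
    by apply: idB => //; apply: idN.
  by rewrite mulrBr gE {2}hE'; ring.
exists (g - f * (a + c)), (a + c); split=> //; last by rewrite subrK.
apply: nz2 => //; have -> : xv v * (g - f * (a + c)) = q + f * kill_vertex v h + f * q'.
  by rewrite mulrBr gE {1}hE' yb; ring.
by apply: idD => //; [apply: idD | apply: idM].
Qed.

(** The two claims need each other: a path starting at x in K uses that x_x is regular modulo the
    paths before it. With no paths this holds because J is prime; afterwards a path either meets K
    in its first vertex, which is [attach_preserves], or has only fresh vertices. *)
Lemma paths_regular l ps : uniq (paths_verts ps) ->
  (forall q a, q \in ps -> a \in q.2 -> a \notin l) ->
  regular (paths_gens ps) (minors l) unit_ideal /\
  (forall v, v \in l -> v \notin paths_verts ps ->
     nz (comb (paths_gens ps) (minors l) unit_ideal) (xv v)).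
Proof.
have iJ := @is_ideal_minors k T l.
elim: ps => [_ _|[x p] ps IH un psl].
  split=> // v vl _ g _ /minors_prime [/segre_ker|//].
  by rewrite segre_x => /eqP; rewrite polyC_eq0 -msupp_eq0 msuppX.
have un0 := un; move: un; rewrite /paths_verts [map _ _]/= [flatten _]/=.
rewrite -cat_cons cat_uniq -/(paths_verts ps) => /and3P [un /hasPn dis unps].
have psl' q a : q \in ps -> a \in q.2 -> a \notin l.
  by move=> hq; apply: psl; rewrite inE hq orbT.
have pl a : a \in p -> a \notin l by apply: (psl (x, p)); rewrite mem_head.
have [reg nzx] := IH unps psl'.
have iQ : is_ideal (comb (paths_gens ps) (minors l) unit_ideal) by apply: is_ideal_comb.
have fr a : a \in x :: p -> a \notin l ->
  vfresh a (comb (paths_gens ps) (minors l) unit_ideal).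
  move=> ha hal; apply: vfresh_comb => //; first exact: vfresh_minors.
  by move=> f; apply: paths_gens_vfree; apply/negP => /dis /=; rewrite ha.
split.
  rewrite /paths_gens [map _ _]/= [flatten _]/= regular_cat; split=> //.
  apply: path_regular => //; first by move=> w hw; apply: fr (pl _ hw); rewrite inE hw orbT.
  left; have [xl|xl] := boolP (x \in l); last by apply: nz_xv => //; apply: fr;
    rewrite ?mem_head.
  by apply: nzx => //; apply/negP => /dis /=; rewrite mem_head.
move=> v vl vn; have vps : v \notin paths_verts ps.
  by apply: contraNN vn => h; rewrite /paths_verts /= inE mem_cat h !orbT.
have [xl|xl] := boolP (x \in l).
  by case: p un un0 psl dis pl fr vn => [|w p] *;
    [apply: nzx | apply: attach_preserves => //; apply: nzx].
have xv' : v != x by apply: contraTneq vl => ->.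
rewrite /paths_gens [map _ _]/= [flatten _]/= comb_cat; apply: path_preserves => //.
- exact: nzx.
- move=> w hw; split; first by apply: fr (pl _ hw); rewrite inE hw orbT.
  by apply: vfree_xv; apply: contraNneq (pl _ hw) => ->.
left; apply: nz_xv; first exact: is_ideal_comb.
apply: vfresh_comb => //; first by apply: fr; rewrite ?mem_head.
by move=> f /[1!inE] /eqP ->; apply: vfree_xv; rewrite eq_sym.
Qed.

End PathRegularity.

(** * The linear resolution of the minors and the regularity of products *)

Section RegularOnIdeal.
Variable R : comNzRingType.
Implicit Types J Q : R -> Prop.

Lemma comb_decomp s Q h : comb s Q unit_ideal h ->
  exists a b, [/\ comb s zero_ideal unit_ideal a, Q b & h = a + b].
Proof.
elim: s h => [h hh|f s IH h] /=; first by exists 0, h; rewrite add0r.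
move=> [_ [c [/IH [a [b [ha hb ->]]] _ ->]]].
exists (a + f * c), b; split=> //; last by ring.
by exists a, c.
Qed.

(** If h = a + f c lies in J, then f c lies in (s) + J, so c = a' + b with a' in (s) and b in J.
    Subtracting f b from h leaves an element of both (s) and J, to which induction applies. *)
Lemma comb_cap s J h : is_ideal J ->
  regular s zero_ideal unit_ideal -> regular s J unit_ideal ->
  comb s zero_ideal unit_ideal h -> J h -> comb s zero_ideal J h.
Proof.
move=> iJ; elim: s h => [|f s IH] h //= [reg0 nz0] [regJ nzJ] [a [c [ha _ hE]]] hJ.
have iz := @is_ideal_zero R; have iu := @is_ideal_unit R.
have [a' [b [ha' hb cE]]] : exists a b,
    [/\ comb s zero_ideal unit_ideal a, J b & c = a + b].
  apply: comb_decomp; apply: nzJ => //.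
  have -> : f * c = h - a by rewrite hE; ring.
  apply: idB; [exact: is_ideal_comb | exact: comb_base |].
  by apply: comb_min ha => [|_ ->|g d hg _]; [exact: is_ideal_comb
    | exact: id0 (is_ideal_comb _ _ _) | exact: comb_gen].
exists (a + f * a'), b; split=> //; last by rewrite hE cE; ring.
apply: IH => //; first by apply: idD; [exact: is_ideal_comb | | apply: idM;
  first exact: is_ideal_comb].
have -> : a + f * a' = h - f * b by rewrite hE cE; ring.
by apply: idB => //; apply: idM.
Qed.

(** If g is in J and f g in (s) J, regularity on S puts g in (s), and (s) meets J in (s) J. *)
Lemma regular_on_ideal s J : is_ideal J ->
  regular s zero_ideal unit_ideal -> regular s J unit_ideal -> regular s zero_ideal J.
Proof.
move=> iJ; elim: s => [|f s IH] //= [reg0 nz0] [regJ nzJ]; split; first exact: IH.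
have iz := @is_ideal_zero R; have iu := @is_ideal_unit R.
move=> g gJ hg; apply: comb_cap => //; apply: nz0 => //.
apply: comb_min hg => [|_ ->|x c hx _]; [exact: is_ideal_comb
    | exact: id0 (is_ideal_comb _ _ _) | exact: comb_gen].
Qed.

End RegularOnIdeal.

(** * Linear resolutions of ideals of variables and of 2-minors *)

Section MinorsResolution.
Variables (k : fieldType) (T : finType).
Local Notation N := (#|T| + #|T|)%N.
Local Notation S := {mpoly k[N]}.
Local Notation xv := (@xvar k T).
Local Notation yv := (@yvar k T).
Implicit Types (l : seq T) (w u v : T).

Definition var_ideal l : S -> Prop := comb [seq xv u | u <- l] zero_ideal unit_ideal.

Lemma is_ideal_var_ideal l : is_ideal (var_ideal l).
Proof. by apply: is_ideal_comb; [exact: is_ideal_zero | exact: is_ideal_unit]. Qed.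

Lemma xv_homog u : xv u \is 1.-homog.
Proof. by rewrite dhomogX /= mdeg1. Qed.

Lemma yv_homog u : yv u \is 1.-homog.
Proof. by rewrite dhomogX /= mdeg1. Qed.

Lemma minor_homog u v : minor k u v \is 2.-homog.
Proof.
by apply: rpredB; apply: (@dhomogM _ _ _ 1 _ 1); rewrite ?xv_homog ?yv_homog.
Qed.

Lemma edge_homog u v : edge k u v \is 2.-homog.
Proof.
by apply: rpredB; apply: (@dhomogM _ _ _ 1 _ 1); rewrite ?xv_homog ?yv_homog.
Qed.

Lemma var_ideal_regular l : uniq l ->
  regular [seq xv u | u <- l] zero_ideal unit_ideal.
Proof.
elim: l => //= w l IH /andP [wl /IH reg]; split=> //.
have iz := @is_ideal_zero S; apply: nz_xv; first exact: is_ideal_var_ideal.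
apply: vfresh_comb => //; first exact: vfresh_zero.
by move=> _ /mapP [u hu ->]; apply: vfree_xv; apply: contraNneq wl => ->.
Qed.

(** A Koszul complex, obtained from [comb_res] with M = S, c = 0 and d = 1. As d - 1 = 0, the lower
    and upper bounds on the shifts meet. *)
Lemma var_ideal_res l : uniq l -> exists (C : cplx k N) aug,
  resolution (C := C) aug (var_ideal l) zero_ideal /\ (forall i a, @sh _ _ C i a = i + 1)%N.
Proof.
move=> /var_ideal_regular reg.
have [|||||C [aug [r hs _]]] := @comb_res k N unit_ideal _ _ 0 1
  [seq xv u | u <- l] (cplx1_res k N).
- exact: is_ideal_unit.
- by move=> [|i] // [].
- by [].
- by move=> _ /mapP [u _ ->]; apply: xv_homog.
- exact: reg.
exists C, aug; split=> // i a; case: (hs i a) => /=; rewrite muln0; lia.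
Qed.

Lemma minors_sub_var l h : minors l h -> var_ideal l h.
Proof.
have iX := is_ideal_var_ideal l; apply: minors_min => // u v hu hv.
have X a : a \in l -> var_ideal l (xv a).
  move=> ha; rewrite -[xv a]mulr1; apply: comb_gen => //;
    [exact: is_ideal_zero | exact: map_f].
by apply: idB => //; apply: idMr => //; apply: X.
Qed.

(** The map x_u |-> x_u y_w - x_w y_u is only well defined modulo J, so it is handled through
    coefficient rows applied to [xcol] or to [mcol]. The default of [nth] is never reached. *)
Definition xcol l w : 'cV[S]_(size l) := \col_i xv (nth w l i).
Definition mcol l w : 'cV[S]_(size l) := \col_i minor k (nth w l i) w.

Lemma is_ideal_rows (L : S -> Prop) n (c : 'cV[S]_n) : is_ideal L ->
  is_ideal (fun h => exists u : 'rV_n, L (h - (u *m c) 0 0)).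
Proof.
move=> iL; split=> [|a b [u hu] [v hv]|c' a [u hu]].
- by exists 0; rewrite mul0mx mxE subr0; apply: id0.
- exists (u + v); rewrite mulmxDl [X in _ - X]mxE opprD addrACA; exact: idD.
- exists (c' *: u); rewrite -scalemxAl [X in _ - X]mxE -mulrBr; exact: idM.
Qed.

Lemma nth_row (f : T -> S) l w u : u \in l ->
  exists c : 'rV_(size l), f u = (c *m \col_i f (nth w l i)) 0 0.
Proof.
move=> hu; have lt : (index u l < size l)%N by rewrite index_mem.
by exists (delta_mx 0 (Ordinal lt)); rewrite -rowE !mxE nth_index.
Qed.

Lemma var_ideal_row l w h : var_ideal l h ->
  exists c : 'rV_(size l), h = (c *m xcol l w) 0 0.
Proof.
move=> hh; pose L h := exists u : 'rV_(size l), zero_ideal (h - (u *m xcol l w) 0 0).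
have iL : is_ideal L by apply: is_ideal_rows; apply: is_ideal_zero.
suff [c /eqP] : L h by rewrite subr_eq0 => /eqP; exists c.
apply: (comb_min iL) hh => [_ ->|_ c /mapP [u hu ->] _]; first exact: id0.
apply: idMr => //; have [c' ->] := nth_row (@xvar k T) w hu.
by exists c'; apply/eqP; rewrite subr_eq0.
Qed.

Lemma minors_cons_row l w h : minors (w :: l) h ->
  exists c : 'rV_(size l), minors l (h - (c *m mcol l w) 0 0).
Proof.
have iJ := @is_ideal_minors k T l.
pose L h := exists c : 'rV_(size l), minors l (h - (c *m mcol l w) 0 0).
have iL : is_ideal L by apply: is_ideal_rows.
have mw u : u \in l -> L (minor k u w).
  move=> /(nth_row (fun a => minor k a w) w) [c ->]; exists c.
  by rewrite subrr; apply: id0.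
apply: (minors_min iL) => u v; rewrite !inE => /predU1P [->|hu] /predU1P [->|hv].
- by rewrite /minor subrr; apply: id0 iL.
- rewrite (_ : minor k w v = - minor k v w); first exact: idN (mw v hv).
  by rewrite /minor; ring.
- exact: mw.
by exists 0; rewrite mul0mx mxE subr0; apply: minors_gen.
Qed.

Lemma polyC_subX_neq0 (R : nzRingType) (a b : R) : a != 0 -> a%:P - b%:P * 'X != 0.
Proof.
apply: contraNneq => /(congr1 (fun p : {poly R} => p`_0)).
by rewrite coefB coefC coefMX coef0 subr0 /= => ->.
Qed.

Lemma mulrBCA (R : comPzRingType) (a b c d : R) : a * b - c * (a * d) = a * (b - c * d).
Proof. by ring. Qed.

Lemma segre_minor l u w : u \in l -> w \notin l ->
  segre l (minor k u w) = segre l (xv u) * ((yv w)%:P - (xv w)%:P * 'X).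
Proof.
move=> ul wl; rewrite /minor segreB !segreM.
rewrite !segre_x !segre_y ul (negPf wl).
exact: mulrBCA.
Qed.

(** Under [segre] the minor of u and w becomes x_u (y_w - x_w t). The second factor is a nonzero
    element of a domain, so both combinations vanish together; this gives well-definedness and
    injectivity of the map at once. *)
Lemma mcol_minors l w (c : 'rV_(size l)) : w \notin l ->
  minors l ((c *m mcol l w) 0 0) <-> minors l ((c *m xcol l w) 0 0).
Proof.
move=> wl.
have e : segre l ((c *m mcol l w) 0 0) =
    segre l ((c *m xcol l w) 0 0) * ((yv w)%:P - (xv w)%:P * 'X).
  rewrite [in LHS]mxE [in RHS]mxE !segre_sum.
  rewrite [RHS]mulr_suml; apply: eq_bigr => i _; rewrite [in LHS]mxE [in RHS]mxE.
  by rewrite !segreM segre_minor ?mem_nth //; apply: mulrA.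
have nz : (yv w)%:P - (xv w)%:P * 'X != 0 :> {poly S}.
  by apply: polyC_subX_neq0; rewrite -msupp_eq0 msuppX.
split=> /segre_ker h; apply/segre_ker; last by rewrite e h; apply: mul0r.
by move: h => /eqP; rewrite e mulf_eq0 (negPf nz) orbF => /eqP.
Qed.

(* J_(w :: l) / J_l is isomorphic to (x_u : u in l) / J_l up to a shift by 1,
   x_u corresponding to x_u y_w - x_w y_u. *)
Lemma minors_res l : uniq l -> exists (C : cplx k N) aug,
  resolution (C := C) aug (minors l) zero_ideal /\ (forall i a, @sh _ _ C i a = i + 2)%N.
Proof.
elim: l => [_|w l IH /= /andP [wl un]].
  by exists (cplx0 k N), 0; split=> [|i []] //; apply: cplx0_res.
have [CA [augA [rA hA]]] := IH un; have [G [augG [rG hG]]] := var_ideal_res un.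
have iJ := @is_ideal_minors k T l; have iX := is_ideal_var_ideal l.
have JX := @minors_sub_var l.
have [io [e0 hio an]] := quot_lift rA rG JX.
have mio i : min_mx (io i).
  by apply: min_mx_shift (hio i) _ => a b; rewrite hA hG; lia.
have rW := quot_res rA rG iJ iX JX e0 hio mio an; set W := tot _ in rW.
set augW := col_mx _ _ in rW.
have hW i a : @sh _ _ W i a = (i + 1)%N.
  rewrite /= /sh_sum; case: (split a) => {}a; first exact: hG.
  by case: i a => [[]|i a] //=; rewrite hA; lia.
have hx : hmx (fun=> 1%N) (fun=> 0%N) (xcol l w).
  by apply/hmx_dhomog => a; rewrite mxE; apply: xv_homog.
(* V writes the generators of the cone in terms of the x_u. The same coefficients applied to the
   minors with w form the new augmentation. *)
have [V [hV eV]] : exists V, hmx (@sh _ _ W 0) (fun=> 1%N) V /\ augW = V *m xcol l w.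
  apply: hlift; [exact: res_aug_hom rW | exact: hx |].
  apply: rows_lift => a; have [c hc] := var_ideal_row w (res_aug rW a).
  by exists c; apply: scalar_mx_ext; rewrite mxE.
have iB := @is_ideal_minors k T (w :: l).
have rC : resolution (C := twist 1 W) (V *m mcol l w) (minors (w :: l)) (minors l).
  apply: (res_transport rW).
  - apply: (@hmx_mul _ _ _ _ _ _ (fun=> 2%N)).
      by move=> a b m /hV /= <-; rewrite -addnA.
    by apply/hmx_dhomog => a; rewrite mxE; apply: minor_homog.
  - move=> a; rewrite mxE; apply: id_sum => // i _; rewrite mxE.
    by apply: idM => //; apply: minors_gen; rewrite ?inE ?eqxx // mem_nth ?orbT.
  - move=> f /minors_cons_row [c hc].
    have [u hu] : exists u : 'rV_(rk W 0),
        minors l ((c *m xcol l w) 0 0 - (u *m augW) 0 0).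
      apply: (res_surj rW); rewrite mxE; apply: id_sum => // i _; apply: idM => //.
      rewrite mxE -[xv _]mulr1; apply: comb_gen => //; first exact: is_ideal_zero.
      by apply: map_f; apply: mem_nth.
    exists u; have -> : f - (u *m (V *m mcol l w)) 0 0 =
        (f - (c *m mcol l w) 0 0) + ((c - u *m V) *m mcol l w) 0 0.
      by rewrite mulmxBl -mulmxA [((_ - _ : 'M_(_, _)) 0 0)]mxE
        [((- _ : 'M_(_, _)) 0 0)]mxE addrA subrK.
    apply: idD => //; apply/mcol_minors => //.
    by rewrite mulmxBl -mulmxA -eV [((_ - _ : 'M_(_, _)) 0 0)]mxE
      [((- _ : 'M_(_, _)) 0 0)]mxE.
  - by move=> u; rewrite mulmxA mcol_minors // -mulmxA -eV.
have [th [t0 hth ath]] := ext_lift rA rC.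
have AB (h : S) : minors l h -> minors (w :: l) h.
  by apply: (minors_min iB) => u v hu hv; apply: minors_gen; rewrite inE ?hu ?hv orbT.
have hC i a : @sh _ _ (twist 1 W) i a = (i + 2)%N.
  by rewrite -[LHS]/(@sh _ _ W i a + 1)%N hW -addnA.
eexists _, _; split.
  apply: (ext_res rA rC iJ iB AB t0 hth _ ath) => i.
  by apply: min_mx_shift (hth i) _ => a b; rewrite hA hC; lia.
move=> i a; rewrite -[LHS]/(sh_sum (@sh _ _ CA i) (@sh _ _ (twist 1 W) i) a) /sh_sum.
by case: (split a) => {}a; [apply: hA | apply: hC].
Qed.

End MinorsResolution.

(** * From a resolution of an ideal to the regularity of its quotient ring *)

Section QuotientRegularity.
Variables (k : fieldType) (N : nat).
Local Notation S := {mpoly k[N]}.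

(** The cone over the inclusion into S moves each generator one homological step up without changing
    its shift, hence [r.+1] for the ideal and r for the quotient. Positive shifts keep the map to S
    free of constants. *)
Lemma reg_quotient_of_res (I : S -> Prop) (C : cplx k N) aug (r : nat) :
  is_ideal I -> resolution (C := C) aug I zero_ideal ->
  (forall i a, 0 < @sh _ _ C i a <= i + r.+1)%N ->
  (exists i a, @sh _ _ C i a = i + r.+1)%N ->
  reg_quotient_eq I r%:Z.
Proof.
move=> iI rA hs [i0 [a0 top]].
have rG := cplx1_res k N; have iu := @is_ideal_unit S.
have IU h : I h -> @unit_ideal S h by [].
have [io [e0 hio an]] := quot_lift rA rG IU.
have mio i : min_mx (io i).
  by apply: min_mx_shift (hio i) _ => a b /=; case/andP: (hs i a); lia.
have rW := quot_res rA rG iI iu IU e0 hio mio an; set W := tot _ in rW.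
set augW := col_mx _ _ in rW.
have hW i a : (@sh _ _ W i a <= i + r)%N.
  rewrite /= /sh_sum; case: (split a) => {}a //.
  by case: i a => [[]|i a] //=; case/andP: (hs i a); lia.
have s0 a : augW a 0 \is (@sh _ _ W 0 a).-homog.
  by move: a; apply/hmx_dhomog; apply: res_aug_hom rW.
have s1 f : exists u : 'rV_(rk W 0), I (f - (u *m augW) 0 0) by apply: (res_surj rW).
pose F := @MinGradedRes k N I (rk W) (@sh _ _ W) augW (df W)
  s0 (res_hom rW) s1 (res_ker rW) (res_acyclic rW) (res_min rW).
exists F; split=> [i j|].
  rewrite -lt0n => /card_gt0P [a]; rewrite inE => /eqP <-.
  by have := hW i a; rewrite Num.Theory.lerBlDl -PoszD lez_nat.
exists i0.+1, (i0 + r.+1)%N; split; last by rewrite addnS -addSn PoszD addrC addKr.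
rewrite -lt0n; apply/card_gt0P; exists (rshift _ a0).
by rewrite inE /= /sh_sum (unsplitK (inr _)) top.
Qed.

End QuotientRegularity.

(** * Paths and free vertices *)

Section Paths.
Variable T : finType.
Implicit Types (x u v : T) (p : seq T) (G : sgraph T).

Definition steps x p := zip (x :: p) p.

Lemma zip_belast x p : steps x p = zip (belast x p) p.
Proof. by rewrite /steps; elim: p x => //= y p IH x; congr (_ :: _). Qed.

Lemma size_steps x p : size (steps x p) = size p.
Proof. by rewrite size2_zip //= leqnSn. Qed.

Lemma nth_steps x p i : (i < size p)%N ->
  nth (x, x) (steps x p) i = (nth x (x :: p) i, nth x (x :: p) i.+1).
Proof. by move=> lt; rewrite nth_zip_cond size_steps lt. Qed.

Lemma steps_nth x p i : (i < size p)%N ->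
  (nth x (x :: p) i, nth x (x :: p) i.+1) \in steps x p.
Proof. by move=> lt; rewrite -nth_steps // mem_nth // size_steps. Qed.

Lemma steps_index x p e : uniq (x :: p) -> e \in steps x p ->
  (index e.1 (x :: p) < size p)%N /\ index e.2 (x :: p) = (index e.1 (x :: p)).+1.
Proof.
move=> un /(nthP (x, x)) [i]; rewrite size_steps => lt <-; rewrite nth_steps //.
have lt1 : (i < size (x :: p))%N by exact: ltnW.
rewrite [_.1]/= [_.2]/= index_uniq //; split=> //;
  exact: (@index_uniq _ x i.+1 (x :: p) lt un).
Qed.

Definition edge_set x p : {set {set T}} := [set [set e.1; e.2] | e in steps x p].

(** Lets a path be read from its other end, so that its vertex in K can be put first. *)
Lemma edge_set_rev x p :
  edge_set (last x p) (rev (belast x p)) = edge_set x p.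
Proof.
have bl : belast (last x p) (rev (belast x p)) = rev p.
  have := lastI (last x p) (rev (belast x p)).
  by rewrite -rev_rcons -lastI rev_cons => /rcons_inj [].
have sz : size (belast x p) = size p by rewrite size_belast.
have mem e : (e \in steps (last x p) (rev (belast x p))) = ((e.2, e.1) \in steps x p).
  rewrite !zip_belast bl -rev_zip // mem_rev.
  apply/(nthP (x, x))/(nthP (x, x)) => -[i]; rewrite size_zip sz minnn => lt.
    rewrite nth_zip // => <-; exists i; rewrite ?size_zip ?sz ?minnn //.
    by rewrite nth_zip.
  rewrite nth_zip // => -[e1 e2]; exists i; rewrite ?size_zip ?sz ?minnn //.
  by rewrite nth_zip // e1 e2; case: e {e1 e2}.
apply/setP => A; apply/imsetP/imsetP => -[e he ->].
  by exists (e.2, e.1); rewrite -?mem 1?setUC // mem in he *.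
by exists (e.2, e.1); rewrite ?mem 1?setUC //; case: e he.
Qed.

Lemma set2_eq (a b c d : T) : [set a; b] = [set c; d] ->
  (a = c /\ b = d) \/ (a = d /\ b = c).
Proof.
move=> E; have ha : a \in [set c; d] by rewrite -E !inE eqxx.
have hb : b \in [set c; d] by rewrite -E !inE eqxx orbT.
have hc : c \in [set a; b] by rewrite E !inE eqxx.
have hd : d \in [set a; b] by rewrite E !inE eqxx orbT.
move: ha hb hc hd; rewrite !inE.
case/orP => /eqP ->; case/orP => /eqP ->; rewrite ?eqxx /=; auto.
  by rewrite orbb => _ /eqP ->; left.
by rewrite orbb => /eqP -> _; left.
Qed.

Lemma card_edge_set x p : uniq (x :: p) -> #|edge_set x p| = size p.
Proof.
move=> un; rewrite card_in_imset; last first.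
  move=> [a b] [c d] h1 h2 /= /set2_eq [[-> ->] //|[e1 e2]].
  (* Two steps with the same edge but opposite directions would make each of two indices the
     successor of the other. *)
  have [_ /= i1] := steps_index un h1; have [_ /= i2] := steps_index un h2.
  by move: i1 i2; rewrite /= -e1 -e2; lia.
rewrite -(size_steps x p); apply/card_uniqP; apply: zip_uniql.
by case: un => /=.
Qed.

(* An inner vertex of a path lies in the two maximal cliques spanned by the
   edges at it. *)
Lemma free_vertex_path G x p v : uniq (x :: p) -> vset G = [set y in x :: p] ->
  eset G = edge_set x p -> v \in x :: p -> free_vertex G v -> v = x \/ v = last x p.
Proof.
move=> un vG eG vp /cards1P [C0 hC0].
have [->|vx] := eqVneq v x; first by left.
have [->|vl] := eqVneq v (last x p); [by right | exfalso].
have [j jE] : exists j, index v (x :: p) = j.+1.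
  by exists (index v p); rewrite /= eq_sym (negPf vx).
have jlt : (j.+1 < size p)%N.
  have le : (j.+1 <= size p)%N by rewrite -ltnS -jE
    -[(size p).+1]/(size (x :: p)) index_mem.
  rewrite ltn_neqAle le andbT; apply: contraNneq vl => h; apply/eqP.
  by rewrite -[LHS](nth_index x vp) jE h (last_nth x).
pose a := nth x (x :: p) j; pose b := nth x (x :: p) j.+2.
have vE : v = nth x (x :: p) j.+1 by rewrite -jE nth_index.
have ia : index a (x :: p) = j by rewrite index_uniq //=; lia.
have ib : index b (x :: p) = j.+2 by rewrite index_uniq //=; lia.
have ap : a \in x :: p by rewrite mem_nth //=; lia.
have bp : b \in x :: p by rewrite mem_nth //=; lia.
have eav : [set a; v] \in eset G.
  by rewrite eG vE; apply/imsetP; exists (a, nth x (x :: p) j.+1) => //;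
    apply: steps_nth; lia.
have evb : [set v; b] \in eset G.
  by rewrite eG vE; apply/imsetP; exists (nth x (x :: p) j.+1, b) => //;
    apply: steps_nth; lia.
have cl u w : u \in x :: p -> w \in x :: p -> [set u; w] \in eset G -> clique G [set u; w].
  move=> hu hw euw; apply/andP; split.
    by rewrite vG; apply/subsetP => y; rewrite !inE => /orP [] /eqP ->; rewrite -in_cons.
  apply/forall_inP => y /set2P [] ->; apply/forall_inP => z /set2P [] ->;
    apply/implyP; rewrite ?eqxx // => _ //.
  by rewrite setUC.
have [C1 max1 sub1] := maxset_exists (cl a v ap vp eav).
have [C2 max2 sub2] := maxset_exists (cl v b vp bp evb).
have e1 : C1 = C0.
  apply/set1P; rewrite -hC0 inE max1; apply: (subsetP sub1); exact: set22.
have e2 : C2 = C0.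
  apply/set1P; rewrite -hC0 inE max2; apply: (subsetP sub2); exact: set21.
have /andP [_ /forall_inP /(_ a) h] := maxsetp max1.
have aC : a \in C1 by apply: (subsetP sub1); exact: set21.
have bC : b \in C1 by rewrite e1 -e2; apply: (subsetP sub2); exact: set22.
have ab : a != b by apply/eqP => E; move: ia; rewrite E ib; clear; lia.
have /forall_inP /(_ b bC) /implyP /(_ ab) := h aC.
rewrite eG => /imsetP [[c d] hcd /= /set2_eq [[ac bd]|[ad bc]]].
  have [_] := steps_index un hcd; rewrite [_.1]/= [_.2]/= -ac -bd ib ia.
  by clear; lia.
have [_] := steps_index un hcd; rewrite [_.1]/= [_.2]/= -ad -bc ib ia.
by clear; lia.
Qed.

(** A free vertex of a path is an end, so after a possible reversal only the starting vertex can lie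
    in A. *)
Lemma path_from_complete G (A : {set T}) : is_path G ->
  (A :&: vset G != set0 -> exists v, A :&: vset G = [set v] /\ free_vertex G v) ->
  exists q : T * seq T, [/\ uniq (q.1 :: q.2), vset G = [set y in q.1 :: q.2],
    eset G = edge_set q.1 q.2 & forall w, w \in q.2 -> w \notin A].
Proof.
move=> [x [p [un vG eG]]] hA.
have [A0|/hA [v [Av fv]]] := eqVneq (A :&: vset G) set0.
  exists (x, p); split=> // w wp; apply: contraTN isT => wA.
  by have := in_set0 w; rewrite -A0 inE wA vG inE inE wp orbT.
have onA w : w \in x :: p -> w \in A -> w = v.
  by move=> wp wA; apply/set1P; rewrite -Av inE wA vG inE.
have vp : v \in x :: p.
  by have := set11 v; rewrite -Av inE vG inE => /andP [].
have [vx|vl] := free_vertex_path un vG eG vp fv.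
  exists (x, p); split=> // w wp; apply/negP => wA.
  by move: un; rewrite /= -vx -(onA w) ?wp // inE wp orbT.
have rv : last x p :: rev (belast x p) = rev (x :: p) by rewrite [in RHS]lastI rev_rcons.
have unr : uniq (last x p :: rev (belast x p)) by rewrite rv rev_uniq.
exists (last x p, rev (belast x p)); split=> [//| | |w wp].
- by rewrite /= rv vG; apply/setP => y; rewrite !inE mem_rev.
- by rewrite /= edge_set_rev.
apply/negP => wA; have wv : w = v.
  by apply: onA => //; rewrite -mem_rev -rv inE wp orbT.
by move: unr; rewrite /= -vl -wv wp.
Qed.

Lemma eset_sub G e : e \in eset G -> #|e| = 2 /\ e \subset vset G.
Proof. by case: G => V E /= /forall_inP h /h /andP [/eqP]. Qed.

End Paths.

(** * The ideals of the statement as combinations of explicit lists of generators *)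

Section IdealTranslation.
Variable R : comNzRingType.
Implicit Types (A I J L : R -> Prop).

Lemma is_ideal_gen A : is_ideal (ideal_gen A).
Proof.
split=> [|_ _ [s hs ->] [t ht ->]|c _ [s hs ->]].
- by exists [::]; rewrite ?big_nil.
- exists (s ++ t); last by rewrite big_cat.
  by move=> cg; rewrite mem_cat => /orP [/hs|/ht].
exists [seq (c * cg.1, cg.2) | cg <- s]; first by move=> _ /mapP [cg /hs h ->].
by rewrite big_map mulr_sumr; apply: eq_bigr => cg _; rewrite mulrA.
Qed.

Lemma ideal_gen_mem A f : A f -> ideal_gen A f.
Proof.
by exists [:: (1, f)]; [move=> cg; rewrite inE => /eqP -> | rewrite big_seq1 mul1r].
Qed.

Lemma ideal_gen_min A L : is_ideal L -> (forall f, A f -> L f) ->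
  forall h, ideal_gen A h -> L h.
Proof.
move=> iL h _ [s hs ->]; rewrite big_seq; apply: id_sum => // cg /hs hcg.
by apply: idM => //; apply: h.
Qed.

Lemma ideal_mul_comb s I J L h : is_ideal L ->
  (forall f, I f <-> comb s zero_ideal unit_ideal f) -> (forall g, J g <-> L g) ->
  ideal_mul I J h <-> comb s zero_ideal L h.
Proof.
move=> iL IE JE; have iz := @is_ideal_zero R; have iC := is_ideal_comb s iz iL.
split.
  apply: ideal_gen_min => // _ [f [g [/IE hf /JE hg ->]]]; rewrite mulrC.
  apply: (comb_min (is_ideal_colon g iC)) hf => [_ ->|a c ha _].
    by rewrite mulr0; apply: id0.
  by rewrite mulrCA; apply: comb_gen => //; rewrite mulrC; apply: idM.
apply: (comb_min (is_ideal_gen _)) => [_ ->|f c hf hc]; first exact: id0 (is_ideal_gen _).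
apply: ideal_gen_mem; exists f, c; split=> //; [apply/IE | exact/JE].
by rewrite -[f]mulr1; apply: comb_gen.
Qed.

End IdealTranslation.

Section EdgeIdeals.
Variables (k : fieldType) (T : finType).
Local Notation S := {mpoly k[#|T| + #|T|]}.
Implicit Types (G : sgraph T) (ps : seq (T * seq T)).

Lemma minors_complete G f : is_complete G ->
  @binomial_edge_ideal k T G f <-> minors (enum (vset G)) f.
Proof.
move=> cG; have iJ := @is_ideal_minors k T (enum (vset G)); split.
  apply: ideal_gen_min => // _ [u [v [/eset_sub [_ /subsetP s] ->]]].
  by apply: minors_gen; rewrite mem_enum; apply: s; rewrite !inE eqxx ?orbT.
have iB := @is_ideal_gen S; apply: (minors_min (iB _)) => u v; rewrite !mem_enum => hu hv.
have [->|uv] := eqVneq u v; first by rewrite /minor subrr; apply: id0 (iB _).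
apply: ideal_gen_mem; exists u, v; split=> //; rewrite cG inE cards2 uv.
by apply/subsetP => y /set2P [] ->.
Qed.

(** Ensures that J is nonzero when K has two vertices, so that its resolution has a generator and
    the top shift is attained. The monomial x_u y_v occurs in only one of the two terms. *)
Lemma minor_neq0 (u v : T) : u != v -> minor k u v != 0.
Proof.
move=> uv; apply/eqP => /(congr1 (mcoeff (U_(xidx u) + U_(yidx v)))).
rewrite mcoeff0 /minor /xvar /yvar -!mpolyXD mcoeffB !mcoeffX.
rewrite -/(xidx u) -/(xidx v) -/(yidx u) -/(yidx v) eqxx.
case: eqP => [/mnmP /(_ (xidx u))|_ /eqP]; last by rewrite subr0 oner_eq0.
by rewrite !mnmDE !mnm1E !xidx_eq !yxidx_neq eqxx eq_sym (negPf uv).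
Qed.

Lemma path_gensE x (p : seq T) :
  path_gens k x p = rev [seq edge k e.1 e.2 | e <- steps x p].
Proof. by elim: p x => //= y p IH x; rewrite IH rev_cons. Qed.

Lemma edge_sym (u v : T) : edge k u v = edge k v u.
Proof. by rewrite /edge mulrC [X in _ - X]mulrC. Qed.

Lemma parity_ideal_paths G ps f :
  (forall e, e \in eset G <-> exists2 q, q \in ps & e \in edge_set q.1 q.2) ->
  @parity_binomial_edge_ideal k T G f <->
  comb (paths_gens k ps) zero_ideal unit_ideal f.
Proof.
move=> eG; have iz := @is_ideal_zero S; have iu := @is_ideal_unit S.
have iC := is_ideal_comb (paths_gens k ps) iz iu; split.
  apply: ideal_gen_min => // _ [u [v [/eG [q hq /imsetP [e he uv]] ->]]].
  rewrite -/(edge k u v) (_ : edge k u v = edge k e.1 e.2); last first.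
    by case/set2_eq: uv => -[-> ->] //; apply: edge_sym.
  rewrite -[edge _ _ _]mulr1; apply: comb_gen => //; apply/flatten_mapP; exists q => //.
  by rewrite path_gensE mem_rev; exact: (map_f (fun e : T * T => edge k e.1 e.2) he).
have iB := @is_ideal_gen S; apply: (comb_min (iB _)) => [_ ->|g c hg _].
  exact: id0 (iB _).
apply: idMr (iB _) _; apply: ideal_gen_mem; move: hg => /flatten_mapP [q hq].
rewrite path_gensE mem_rev => /mapP [e he ->]; exists e.1, e.2; split=> //.
by apply/eG; exists q => //; apply: imset_f.
Qed.

End EdgeIdeals.

(** * The regularity of the product of the two edge ideals *)

Theorem theorem3p1 (k : fieldType) (T : finType) (m n t : nat)
    (K H : sgraph T) (P : 'I_t -> sgraph T)
    (K_complete : is_complete K) (K_card : #|vset K| = m)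
    (P_path : forall i, is_path (P i))
    (H_union : is_disjoint_union P H)
    (cond1 : forall i, vset K :&: vset (P i) != set0 ->
       exists v, vset K :&: vset (P i) = [set v] /\ free_vertex (P i) v)
    (cond2 : forall i j, i != j ->
       vset K :&: vset (P i) :&: vset (P j) = set0)
    (vertices : vset K :|: vset H = [set: T])
    (H_edges : #|eset H| = n)
    (n_ge1 : (1 <= n)%N) (m_ge2 : (2 <= m)%N) :
  reg_quotient_eq
    (ideal_mul (@parity_binomial_edge_ideal k T H)
               (@binomial_edge_ideal k T K))
    (2 + n%:Z).
Proof.
have [Pdis _ HE] := H_union.
have [q hq] := fin_all_exists (fun i => path_from_complete (P_path i) (cond1 i)).
pose ps := [seq q i | i <- enum 'I_t]; pose l := enum (vset K).
have memV i a : (a \in (q i).1 :: (q i).2) = (a \in vset (P i)).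
  by have [_ -> _ _] := hq i; rewrite in_set.
have un : uniq (paths_verts ps).
  rewrite /paths_verts -map_comp; have := enum_uniq 'I_t.
  elim: (enum 'I_t) => [//|i s IH] /andP [si us].
  rewrite [map _ _]/= [flatten _]/= -cat_cons cat_uniq IH //.
  have [-> _ _ _] := hq i; rewrite andbT /=.
  apply/hasPn => a /flatten_mapP [j js]; rewrite /= !memV => aj; apply/negP => ai.
  have ij : i != j by apply: contraNneq si => ->.
  by have := disjointFr (Pdis i j ij) ai; rewrite aj.
have psl r a : r \in ps -> a \in r.2 -> a \notin l.
  by move=> /mapP [i _ ->]; have [_ _ _ h] := hq i; rewrite mem_enum; apply: h.
have edges e : e \in eset H <-> exists2 r, r \in ps & e \in edge_set r.1 r.2.
  rewrite HE; split=> [/bigcupP [i _ he]|[_ /mapP [i _ ->] he]].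
    by exists (q i); [rewrite map_f ?mem_enum | have [_ _ <- _] := hq i].
  by apply/bigcupP; exists i => //; have [_ _ -> _] := hq i.
have sz : size (paths_gens k ps) = n.
  rewrite -H_edges HE -sum1_card partition_disjoint_bigcup.
    rewrite size_flatten /shape sumnE !big_map -enumT big_enum; apply: eq_bigr => i _.
    rewrite sum1_card; have [un' _ -> _] := hq i; rewrite card_edge_set //.
    by rewrite path_gensE size_rev size_map size_steps.
  move=> i j ij; rewrite -setI_eq0; apply/eqP/setP => e; rewrite !inE.
  apply/negP => /andP [/eset_sub [c2 /subsetP si] /eset_sub [_ /subsetP sj]].
  have [a ae] : exists a, a \in e by apply/card_gt0P; rewrite c2.
  by have := disjointFr (Pdis i j ij) (si a ae); rewrite sj.
have iJ := @is_ideal_minors k T l; have iz := @is_ideal_zero {mpoly k[#|T| + #|T|]}.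
have [regJ _] := paths_regular k un psl.
have reg := regular_on_ideal iJ (paths_regular0 k un) regJ.
have [C [aug [rC hC]]] := minors_res k (enum_uniq (vset K)).
have hom f : f \in paths_gens k ps -> f \is 2.-homog.
  by move=> /flatten_mapP [r _ /path_gens_edge [u [v [_ _ ->]]]]; apply: edge_homog.
(* Here c = 2 is the degree of the minors and d = 2 that of the edge binomials. *)
have [D [augD [rD hD topD]]] := comb_res rC iJ hC (isT : 0 < 2)%N hom reg.
have JE (f : {mpoly k[#|T| + #|T|]}) := minors_complete f K_complete.
have IE (f : {mpoly k[#|T| + #|T|]}) := parity_ideal_paths f edges.
have rk0 : (0 < rk C 0)%N.
  have [u [v [uK vK uv]]] : exists u v, [/\ u \in l, v \in l & u != v].
    have := m_ge2; rewrite -K_card => /card_gt1P [u [v [hu hv uv]]].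
    by exists u, v; rewrite !mem_enum.
  have [w hw] := res_surj rC (minors_gen k uK vK).
  rewrite lt0n; apply/eqP => r0; move: hw; rewrite mxE big1 => [|[i lt] _]; last first.
    by exfalso; rewrite r0 in lt.
  by rewrite /zero_ideal subr0 => /eqP; rewrite (negPf (minor_neq0 k uv)).
have rIJ : resolution augD (ideal_mul (@parity_binomial_edge_ideal k T H)
    (@binomial_edge_ideal k T K)) zero_ideal.
  by apply: res_ideal_ext rD => // h; split=> /(ideal_mul_comb _ iJ IE JE).
apply: (reg_quotient_of_res (is_ideal_gen _) rIJ) => [i a|].
  by case: (hD i a); rewrite sz; lia.
have [|i [a]] := topD _ rk0; first by rewrite -size_eq0 sz -lt0n.
by rewrite sz => e; exists i, a; lia.
Qed.
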